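(* Let $m>2$, $n=2m$, and let $[\xi^{A'}]$ be a parallel projective pure spinor field on a $2m$-dimensional spin complex Riemannian manifold $(\mathcal M,g)$, i.e. $(\nabla_a\xi^{bB})\xi_b{}^{C}=0$ (equivalently $\nabla_a\xi^{B'}=\alpha_a\xi^{B'}$ for some $1$-form $\alpha_a$). Then $$\xi^{aA}\xi^{bB}R_{abcd}=0,\qquad \xi^{aA}\xi^{bB}\Phi_{ab}=0,\qquad \xi^{aA}\xi^{bB}\xi^{cC}C_{abcd}=0,$$ (the last condition being equivalent to ${}^{\mathfrak C}_\xi\Pi^0_{-1}(C)={}^{\mathfrak C}_\xi\Pi^1_{-1}(C)=0$), and in addition, when $m>3$, ${}^{\mathfrak C}_\xi\Pi^2_0(C)=0$. Further, $$R=0\iff{}^{\mathfrak C}_\xi\Pi^0_0(C)=0\ \ (\text{i.e. }\xi^{abA'}C_{abcd}\xi^{cdD'}=0),$$ and in addition, when $m>2$, $$\xi^{aA}\Phi_{ab}=0\iff{}^{\mathfrak C}_\xi\Pi^1_0(C)=0.$$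
   Context: $(\mathcal M,g)$ is a complex manifold of dimension $n=2m$ with a non-degenerate holomorphic section $g_{ab}$ of $\odot^2T^*\mathcal M$ (holomorphic metric), a holomorphic volume form and a holomorphic spin structure; $\nabla_a$ is its holomorphic Levi-Civita connection and the induced spin connection. All fields are holomorphic. The Riemann tensor is defined by $2\nabla_{[a}\nabla_{b]}V^d=R_{abc}{}^dV^c$, so $2\nabla_{[a}\nabla_{b]}\xi^{A'}=-\frac14R_{abcd}\gamma^{cd}{}_{B'}{}^{A'}\xi^{B'}$; $R_{ab}:=R_{acb}{}^c$, $R:=R_a{}^a$, $\Phi_{ab}$ is the tracefree part of $R_{ab}$, and $C_{abcd}$ is the Weyl tensor: $R_{abcd}=C_{abcd}+\frac4{n-2}\Phi_{[c|[a}g_{b]|d]}+\frac2{n(n-1)}Rg_{c[a}g_{b]d}$. $\mathcal S^\pm$ are the chiral spinor bundles; sections of $\mathcal S^+$ have primed upper indices and of $\mathcal S^-$ unprimed ones. Clifford multiplication is given by ($\nabla$-parallel) $\gamma_{aA'}{}^B$, $\gamma_{aA}{}^{B'}$ with $\gamma_{(a|A'}{}^{C}\gamma_{|b)C}{}^{B'}=-g_{ab}\delta_{A'}^{B'}$, $\gamma_{(a|A}{}^{C'}\gamma_{|b)C'}{}^{B}=-g_{ab}\delta_A^B$; $\gamma_{abA'}{}^{B'}:=\gamma_{[a|A'}{}^{C}\gamma_{|b]C}{}^{B'}$. Brackets denote normalised (skew-)symmetrisation. $\xi_a{}^A:=\xi^{B'}\gamma_{aB'}{}^A$, $\xi_{ab}{}^{A'}:=\xi^{B'}\gamma_{abB'}{}^{A'}$.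 $\xi^{A'}$ is pure if it is nowhere zero and at every point the kernel of $\xi_a{}^A:T\mathcal M\to\mathcal S^-$ has dimension $m$; a projective pure spinor field $[\xi^{A'}]$ is a pure spinor field up to scale. The maps used are $${}^{\mathfrak C}_\xi\Pi^0_{-1}(C):=\xi^{aA}\xi^{bB}\xi^{cdC'}C_{abcd},$$ $${}^{\mathfrak C}_\xi\Pi^1_{-1}(C):=\xi^{aA}\xi^{bB}\xi^{cC}C_{abce}+\tfrac1{n+2}\big(\xi^{aA}\xi^{bB}\xi^{cdD'}C_{abcd}\gamma_{eD'}{}^{C}-\xi^{aC}\xi^{b[A|}\xi^{cdD'}C_{abcd}\gamma_{eD'}{}^{|B]}\big),$$ $${}^{\mathfrak C}_\xi\Pi^0_0(C):=\xi^{abB'}\xi^{cdD'}C_{abcd},\qquad {}^{\mathfrak C}_\xi\Pi^1_0(C):=\xi^{abB'}\xi^{cD}C_{abcd}+\tfrac1n\xi^{abB'}\xi^{ceD'}C_{abce}\gamma_{dD'}{}^{D},$$ $${}^{\mathfrak C}_\xi\Pi^2_0(C):=\xi^{aA}C_{a[bc]d}\xi^{dD}+\tfrac1{n-4}\xi^{aeC'}C_{aed[b}\gamma_{c]C'}{}^{[A}\xi^{dD]}-\tfrac1{2(n-2)(n-4)}\xi^{aeC'}C_{aedf}\xi^{dfF'}\gamma_{[b|C'}{}^{A}\gamma_{|c]F'}{}^{D}.$$ *)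

(* Defs.v *)
From HB Require Import structures.
From mathcomp Require Import all_boot all_order all_algebra.
From mathcomp Require Import all_classical all_reals all_analysis.
From mathcomp Require Import complex.

Set Implicit Arguments.
Unset Strict Implicit.
Unset Printing Implicit Defensive.

Import Order.TTheory GRing.Theory Num.Theory.
Import numFieldNormedType.Exports.
Local Open Scope classical_set_scope.
Local Open Scope ring_scope.

(* The name makes the generic norm/topology of a numClosedFieldType
   available on R[i]. *)
Definition Cplx (R : realType) : numClosedFieldType := (R[i])%C.

Section Holomorphic.
Variables (R : realType) (n : nat).
Local Notation C := (Cplx R).

Definition pd (a : 'I_n) (f : 'rV[C]_n -> C) (z : 'rV[C]_n) : C :=
  'D_(delta_mx 0 a) f z.

Fixpoint cdiff (k : nat) (A : set 'rV[C]_n) (f : 'rV[C]_n -> C) : Prop :=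
  if k is k'.+1 then
    (forall z, A z -> differentiable f z) /\ (forall a, cdiff k' A (pd a f))
  else True.

(* On an open set A: smooth with complex-linear differentials.  [differentiable]
   is Frechet differentiability over the field C.  Differentiability to all
   orders is part of the definition (by Cauchy's formula it would follow from
   the first order). *)
Definition holomorphic (A : set 'rV[C]_n) (f : 'rV[C]_n -> C) : Prop :=
  forall k, cdiff k A f.

Definition holomorphic_mx p q (A : set 'rV[C]_n)
    (F : 'rV[C]_n -> 'M[C]_(p, q)) : Prop :=
  forall i j, holomorphic A (fun z => F z i j).

End Holomorphic.

(* A complex manifold of dimension n with an atlas.  [param i] is the inverse
   of the chart map [coord i]; both are junk outside [dom i] and [img i]. *)
Record complexManifold (R : realType) (n : nat) := ComplexManifold {
  points :> topologicalType;
  points_hausdorff : hausdorff_space points;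
  points_second_countable : @second_countable points;
  chart : Type;
  dom : chart -> set points;
  img : chart -> set 'rV[Cplx R]_n;
  coord : chart -> points -> 'rV[Cplx R]_n;
  param : chart -> 'rV[Cplx R]_n -> points;
  dom_cover : forall x, exists i, dom i x;
  dom_open : forall i, open (dom i);
  img_open : forall i, open (img i);
  coordK : forall i x, dom i x -> img i (coord i x) /\ param i (coord i x) = x;
  paramK : forall i z, img i z -> dom i (param i z) /\ coord i (param i z) = z;
  coord_continuous : forall i x, dom i x -> {for x, continuous (coord i)};
  param_continuous : forall i z, img i z -> {for z, continuous (param i)};
  transition_holomorphic : forall i j,
    holomorphic_mx [set z | img i z /\ dom j (param i z)]
      (fun z => coord j (param i z))
}.

Section Metric.
Variables (R : realType) (n : nat) (X : complexManifold R n).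
Local Notation C := (Cplx R).

Definition overlap (i j : chart X) : set 'rV[C]_n :=
  [set z | img i z /\ dom j (param i z)].

Definition transition (i j : chart X) (z : 'rV[C]_n) : 'rV[C]_n :=
  coord j (param i z).

(* Row a, column b: the derivative of the b-th coordinate of chart j along the
   a-th coordinate of chart i. *)
Definition jacobian (i j : chart X) (z : 'rV[C]_n) : 'M[C]_n :=
  \matrix_(a, b) pd a (fun w => transition i j w 0 b) z.

Record holomorphicMetric := HolomorphicMetric {
  gmx :> chart X -> 'rV[C]_n -> 'M[C]_n;
  gmx_holomorphic : forall i, holomorphic_mx (img i) (gmx i);
  gmx_sym : forall i z, img i z -> (gmx i z)^T = gmx i z;
  gmx_unit : forall i z, img i z -> gmx i z \in unitmx;
  gmx_transition : forall i j z, overlap i j z ->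
    gmx i z =
      jacobian i j z *m gmx j (transition i j z) *m (jacobian i j z)^T
}.

(* Holomorphic volume forms vol dz^1 /\ ... /\ dz^n of unit length for g. *)
Record volumeForm (g : holomorphicMetric) := VolumeForm {
  vol :> chart X -> 'rV[C]_n -> C;
  vol_holomorphic : forall i, holomorphic (img i) (vol i);
  vol_unit : forall i z, img i z -> vol i z ^+ 2 = \det (g i z);
  vol_transition : forall i j z, overlap i j z ->
    vol i z = \det (jacobian i j z) * vol j (transition i j z)
}.

Variables (g : holomorphicMetric) (i : chart X).

(* christoffel d a b z is Gamma^d_{ab}. *)
Definition christoffel (d a b : 'I_n) (z : 'rV[C]_n) : C :=
  \sum_e 2^-1 * invmx (g i z) d e *
    (pd a (fun w => g i w b e) z + pd b (fun w => g i w a e) z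
     - pd e (fun w => g i w a b) z).

(* riemann_up z a b c d is R_{abc}^d, with
   (nabla_a nabla_b - nabla_b nabla_a) V^d = R_{abc}^d V^c. *)
Definition riemann_up (z : 'rV[C]_n) (a b c d : 'I_n) : C :=
  pd a (christoffel d b c) z - pd b (christoffel d a c) z
  + \sum_e (christoffel d a e z * christoffel e b c z
            - christoffel d b e z * christoffel e a c z).

Definition riemann (z : 'rV[C]_n) (a b c d : 'I_n) : C :=
  \sum_e riemann_up z a b c e * g i z e d.

End Metric.

(* A Z/2-graded module S+ (+) S- over the Clifford algebra of C^{2m}, with
   g_{ab} = delta_{ab} and gamma_(a gamma_b) = - g_{ab}.  Spinors are row
   vectors and gamma matrices act on the right, so that the row index is the
   lower spinor index: gamP a is gamma_{a A'}^B and gamM a is gamma_{a A}^{B'}.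
   The dimension 2^{m-1} of the halves makes S+ and S- the two chiral spinor
   modules. *)
Record cliffordModule (R : realType) (m : nat) := CliffordModule {
  gamP : 'I_(2 * m) -> 'M[Cplx R]_(2 ^ m.-1);
  gamM : 'I_(2 * m) -> 'M[Cplx R]_(2 ^ m.-1);
  gamPM : forall a b, gamP a *m gamM b + gamP b *m gamM a =
    - (2 * (a == b)%:R)%:M;
  gamMP : forall a b, gamM a *m gamP b + gamM b *m gamP a =
    - (2 * (a == b)%:R)%:M
}.

Section Spin.
Variables (R : realType) (m : nat) (cl : cliffordModule R m).
Local Notation C := (Cplx R).
Local Notation n := (2 * m)%N.
Local Notation N := (2 ^ m.-1)%N.

Definition slashP (u : 'rV[C]_n) : 'M[C]_N := \sum_a u 0 a *: gamP cl a.
Definition slashM (u : 'rV[C]_n) : 'M[C]_N := \sum_a u 0 a *: gamM cl a.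

(* Spin(2m, C), the group of products of an even number of unit vectors in the
   Clifford algebra, through its (faithful) action on S+ (+) S-. *)
Inductive spin_group : 'M[C]_N -> 'M[C]_N -> Prop :=
| spin_one : spin_group 1%:M 1%:M
| spin_mul (u v : 'rV[C]_n) sP sM :
    u *m u^T = 1%:M -> v *m v^T = 1%:M -> spin_group sP sM ->
    spin_group (slashP u *m slashM v *m sP) (slashM u *m slashP v *m sM).

(* A holomorphic spin structure, given by spin frames over the chart domains
   (the atlas being fine enough for such frames to exist) and their transition
   functions.  Row a of [frame i z] holds the coordinates of the vector e_a of
   the oriented orthonormal frame underlying the spin frame; [transP i j] and
   [transM i j] express the frames of S+ and S- over chart i in those over
   chart j.  [trans_frame] says that the spin transition function covers the
   transition function of the orthonormal frames, i.e. that Clifford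
   multiplication, given in all spin frames by the same constant matrices, is
   globally defined. *)
Record spinStructure (X : complexManifold R n) (g : holomorphicMetric X)
    (v : volumeForm g) := SpinStructure {
  frame : chart X -> 'rV[C]_n -> 'M[C]_n;
  frame_holomorphic : forall i, holomorphic_mx (img i) (frame i);
  frame_orthonormal : forall i z, img i z ->
    frame i z *m g i z *m (frame i z)^T = 1%:M;
  frame_oriented : forall i z, img i z -> \det (frame i z) * v i z = 1;
  transP : chart X -> chart X -> 'rV[C]_n -> 'M[C]_N;
  transM : chart X -> chart X -> 'rV[C]_n -> 'M[C]_N;
  transP_holomorphic : forall i j, holomorphic_mx (overlap i j) (transP i j);
  transM_holomorphic : forall i j, holomorphic_mx (overlap i j) (transM i j);
  trans_spin : forall i j z, overlap i j z ->
    spin_group (transP i j z) (transM i j z);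
  transP_cocycle : forall i j k z, overlap i j z -> overlap i k z ->
    transP i k z = transP i j z *m transP j k (transition i j z);
  transM_cocycle : forall i j k z, overlap i j z -> overlap i k z ->
    transM i k z = transM i j z *m transM j k (transition i j z);
  trans_frame : forall i j z, overlap i j z ->
    exists h : 'M[C]_n,
      [/\ frame i z *m jacobian i j z = h *m frame j (transition i j z),
          forall a, gamP cl a *m transM i j z =
            transP i j z *m slashP (row a h)
        & forall a, gamM cl a *m transP i j z =
            transM i j z *m slashM (row a h)]
}.

Section SpinConnection.
Variables (X : complexManifold R n) (g : holomorphicMetric X).
Variables (v : volumeForm g) (S : spinStructure v).
Variables (i : chart X) (z : 'rV[C]_n).

(* omega a b c = g(e_b, nabla_a e_c): the index a is a coordinate index, b and
   c are frame indices. *)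
Definition omega (a b c : 'I_n) : C :=
  \sum_d \sum_e frame S i z b d * g i z d e *
    (pd a (fun w => frame S i w c e) z
     + \sum_f christoffel g i e a f z * frame S i z c f).

(* Components of the curvature in the orthonormal frame.  As g_{ab} is then
   delta_{ab}, upper and lower frame indices need not be distinguished. *)
Definition frame_riemann (a b c d : 'I_n) : C :=
  \sum_a' \sum_b' \sum_c' \sum_d'
    frame S i z a a' * frame S i z b b' * frame S i z c c' * frame S i z d d'
    * riemann g i z a' b' c' d'.

(* nabla_a psi = d_a psi + psi Gamma_a for psi in S+ (spin_connP) or S-
   (spin_connM): the image of omega_a under so(n) = spin(n); see
   [gamP_parallel]. *)
Definition spin_connP (a : 'I_n) : 'M[C]_N :=
  4^-1 *: \sum_b \sum_c omega a b c *: (gamP cl b *m gamM cl c).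
Definition spin_connM (a : 'I_n) : 'M[C]_N :=
  4^-1 *: \sum_b \sum_c omega a b c *: (gamM cl b *m gamP cl c).

End SpinConnection.

(* The Clifford multiplication S+ (x) T -> S- is parallel. *)
Lemma gamP_parallel (w : 'I_n -> 'I_n -> C) (j : 'I_n) :
  (forall b c, w b c = - w c b) ->
  gamP cl j *m (4^-1 *: \sum_b \sum_c w b c *: (gamM cl b *m gamP cl c))
  - (4^-1 *: \sum_b \sum_c w b c *: (gamP cl b *m gamM cl c)) *m gamP cl j
  = \sum_b w b j *: gamP cl b.
Proof.
move=> wN.
have comm b c : gamP cl j *m (gamM cl b *m gamP cl c)
    - gamP cl b *m gamM cl c *m gamP cl j
    = (2 * (j == c)%:R) *: gamP cl b - (2 * (j == b)%:R) *: gamP cl c.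
  have /(canRL (addrK _)) E1 := gamPM cl j b.
  have /(canRL (addrK _)) E2 := gamMP cl j c.
  rewrite mulmxA E1 mulmxBl mulNmx mul_scalar_mx -(mulmxA _ (gamM cl j)) E2 mulmxBr.
  rewrite mulmxN mul_mx_scalar mulmxA.
  by rewrite opprB opprK -addrA addrAC subrr add0r addrC.
rewrite -scalemxAr -scalemxAl -scalerBr mulmx_sumr mulmx_suml -sumrB.
have -> : \sum_b (gamP cl j *m (\sum_c w b c *: (gamM cl b *m gamP cl c))
    - (\sum_c w b c *: (gamP cl b *m gamM cl c)) *m gamP cl j)
    = \sum_b \sum_c (w b c * (2 * (j == c)%:R)) *: gamP cl b
      - \sum_b \sum_c (w b c * (2 * (j == b)%:R)) *: gamP cl c.
  rewrite -sumrB; apply: eq_bigr => b _.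
  rewrite mulmx_sumr mulmx_suml -!sumrB; apply: eq_bigr => c _.
  by rewrite -scalemxAr -scalemxAl -scalerBr comm scalerBr !scalerA.
have -> : \sum_b \sum_c (w b c * (2 * (j == c)%:R)) *: gamP cl b
    = \sum_b (2 * w b j) *: gamP cl b.
  apply: eq_bigr => b _; rewrite (bigD1 j) //= big1 ?addr0 => [|c /negPf cj].
    by rewrite eqxx mulr1 mulrC.
  by rewrite eq_sym cj !mulr0 scale0r.
rewrite [X in _ - X](bigD1 j) //= [X in _ - (_ + X)]big1 ?addr0; last first.
  by move=> b /negPf bj; apply: big1 => c _; rewrite eq_sym bj !mulr0 scale0r.
rewrite -sumrB scaler_sumr; apply: eq_bigr => b _.
rewrite eqxx mulr1 (wN j b) -scalerBl scalerA; congr (_ *: _).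
by rewrite mulNr opprK [w b j * 2]mulrC -mulrDl mulrA -natrD mulVf ?mul1r ?pnatr_eq0.
Qed.

Section Projective.
Variables (X : complexManifold R n) (g : holomorphicMetric X).
Variables (v : volumeForm g) (S : spinStructure v).

(* xi_a^A and xi_{ab}^{A'} for a spinor xi^{A'} at a point. *)
Definition xi1 (xi : 'rV[C]_N) (a : 'I_n) (A : 'I_N) : C :=
  (xi *m gamP cl a) 0 A.
Definition xi2 (xi : 'rV[C]_N) (a b : 'I_n) (A : 'I_N) : C :=
  (xi *m (2^-1 *: (gamP cl a *m gamM cl b - gamP cl b *m gamM cl a))) 0 A.

Definition pure_spinor (xi : 'rV[C]_N) : Prop :=
  xi != 0 /\ \rank (kermx (\matrix_(a < n, A < N) xi1 xi a A)) = m.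

(* Pure spinors up to scale: holomorphic sections of S+ over the chart domains
   which agree up to a nonzero factor. *)
Definition projective_pure_spinor (xi : chart X -> 'rV[C]_n -> 'rV[C]_N) :
    Prop :=
  [/\ forall i, holomorphic_mx (img i) (xi i),
      forall i z, img i z -> pure_spinor (xi i z)
    & forall i j z, overlap i j z ->
        exists2 k : C, k != 0 &
          xi j (transition i j z) = k *: (xi i z *m transP S i j z)].

(* nabla_a xi^{bB}, with a a coordinate index and b a frame index. *)
Definition nabla_xi1 (xi : chart X -> 'rV[C]_n -> 'rV[C]_N) (i : chart X)
    (z : 'rV[C]_n) (a b : 'I_n) (B : 'I_N) : C :=
  pd a (fun w => xi1 (xi i w) b B) z
  + \sum_c omega S i z a b c * xi1 (xi i z) c B
  + \sum_A xi1 (xi i z) b A * spin_connM S i z a A B.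

Definition parallel_projective (xi : chart X -> 'rV[C]_n -> 'rV[C]_N) : Prop :=
  forall i z, img i z -> forall a B D,
    \sum_b nabla_xi1 xi i z a b B * xi1 (xi i z) b D = 0.

End Projective.

(* Tensors at a point, in an orthonormal frame. *)
Section Algebra.
Local Notation tensor4 := ('I_n -> 'I_n -> 'I_n -> 'I_n -> C).
Local Notation dlt a b := ((a == b)%:R : C).

Definition ricci (Rm : tensor4) (a b : 'I_n) : C := \sum_c Rm a c b c.
Definition scalar_curv (Rm : tensor4) : C := \sum_a ricci Rm a a.
Definition tracefree_ricci (Rm : tensor4) (a b : 'I_n) : C :=
  ricci Rm a b - scalar_curv Rm / n%:R * dlt a b.

Definition weyl (Rm : tensor4) (a b c d : 'I_n) : C :=
  let Phi := tracefree_ricci Rm in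
  Rm a b c d
  - 4 / (n%:R - 2) *
      (4^-1 * (Phi c a * dlt b d - Phi c b * dlt a d
               - Phi d a * dlt b c + Phi d b * dlt a c))
  - 2 / (n%:R * (n%:R - 1)) * scalar_curv Rm *
      (2^-1 * (dlt c a * dlt b d - dlt c b * dlt a d)).

Definition weyl_type (W : tensor4) : Prop :=
  [/\ forall a b c d, W a b c d = - W b a c d,
      forall a b c d, W a b c d = - W a b d c,
      forall a b c d, W a b c d = W c d a b,
      forall a b c d, W a b c d + W b c a d + W c a b d = 0
    & forall a b, \sum_c W a c b c = 0].

Variables (xi : 'rV[C]_N) (W : tensor4).

(* [PiC_k_i] is the map with upper index k and lower index i; the suffix
   m1 stands for the lower index -1. *)
Definition PiC_0_m1 (A B C' : 'I_N) : C :=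
  \sum_a \sum_b \sum_c \sum_d
    xi1 xi a A * xi1 xi b B * xi2 xi c d C' * W a b c d.

Definition PiC_1_m1 (A B D : 'I_N) (e : 'I_n) : C :=
  (\sum_a \sum_b \sum_c xi1 xi a A * xi1 xi b B * xi1 xi c D * W a b c e)
  + (n%:R + 2)^-1 *
    ((\sum_D' PiC_0_m1 A B D' * gamP cl e D' D)
     - 2^-1 * ((\sum_D' PiC_0_m1 D A D' * gamP cl e D' B)
               - (\sum_D' PiC_0_m1 D B D' * gamP cl e D' A))).

Definition PiC_0_0 (B' D' : 'I_N) : C :=
  \sum_a \sum_b \sum_c \sum_d xi2 xi a b B' * xi2 xi c d D' * W a b c d.

Definition PiC_1_0 (B' D : 'I_N) (d : 'I_n) : C :=
  (\sum_a \sum_b \sum_c xi2 xi a b B' * xi1 xi c D * W a b c d)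
  + n%:R^-1 * \sum_D' PiC_0_0 B' D' * gamP cl d D' D.

(* The three terms of PiC_2_0 before skew-symmetrisation. *)
Definition PiC_2_0_fst (A D : 'I_N) (b c : 'I_n) : C :=
  \sum_a \sum_d xi1 xi a A * W a b c d * xi1 xi d D.
Definition PiC_2_0_snd (A D : 'I_N) (b c : 'I_n) : C :=
  \sum_a \sum_e \sum_d \sum_C'
    xi2 xi a e C' * W a e d b * gamP cl c C' A * xi1 xi d D.
Definition PiC_2_0_trd (A D : 'I_N) (b c : 'I_n) : C :=
  \sum_a \sum_e \sum_d \sum_f \sum_C' \sum_F'
    xi2 xi a e C' * W a e d f * xi2 xi d f F'
    * gamP cl b C' A * gamP cl c F' D.

Definition PiC_2_0 (A D : 'I_N) (b c : 'I_n) : C :=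
  2^-1 * (PiC_2_0_fst A D b c - PiC_2_0_fst A D c b)
  + (n%:R - 4)^-1 *
    (4^-1 * (PiC_2_0_snd A D b c - PiC_2_0_snd A D c b
             - PiC_2_0_snd D A b c + PiC_2_0_snd D A c b))
  - (2 * (n%:R - 2) * (n%:R - 4))^-1 *
    (2^-1 * (PiC_2_0_trd A D b c - PiC_2_0_trd A D c b)).

End Algebra.

End Spin.

(* Main.v *)
From HB Require Import structures.
Require Import Defs.
From mathcomp Require Import all_boot all_order all_algebra.
From mathcomp Require Import all_classical all_reals all_analysis.
From mathcomp Require Import complex ring.
Local Open Scope ring_scope.

Set Implicit Arguments.
Unset Strict Implicit.
Unset Printing Implicit Defensive.
Import Order.TTheory GRing.Theory Num.Theory.
Import numFieldNormedType.Exports.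

(* At each point the vectors xi^{aA} span a totally null m-plane N, equal to its
   own orthogonal complement.  Parallelism of [xi] says that the covariant
   derivative of a section of N stays in N; differentiating g(nabla_a s, t) = 0
   once more, for sections s and t of N, gives R_{abcd} s^c t^d = 0.
   The rest is linear algebra.  Write g = P + P^T with P of image N (the choice
   of P amounts to the choice of a null complement of N).  A 2-form f that
   vanishes on N x N satisfies xi^{ab} f_{ab} = - 2 (P^{ab} f_{ab}) xi, and by
   the Bianchi identity P^{ae} R_{aedb} v^d = - R_{db} v^d for v in N.  Hence
   for v in N
     xi^{ae} C_{aedb} v^d
       = (2 (n-4)/(n-2) Phi_{db} v^d + 2 (n-2)/(n (n-1)) R v_b) xi,
   and contracting once more,
     xi^{ab} xi^{cd} C_{abcd} = - 2 (n-2)/(n-1) R xi xi. *)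

(** * Tensor algebra relative to a totally null subspace *)

(** The curvature of the spin bundle never enters. The only trace of the spin connection in the
    hypothesis is a term killed by contraction with xi^{bC}, since N is null; what is left is a
    condition on the vectors xi^{aA}. These 2^(m-1) vectors span N redundantly, and the argument
    runs on this family, so that no basis of N has to be chosen. The second differentiation uses two
    facts: nabla_a s and nabla_c t are again orthogonal for s, t in N, and mixed complex derivatives
    commute. As holomorphy means complex differentiability to all orders, the latter is derived from
    the mean value inequality. The formula for xi^{ab} f_{ab} comes from v^a xi_{ab} = v_b xi for v
    in N, which determines xi_{ab} up to a bivector of N: modulo such bivectors it is P^T - P times
    xi. *)

Section PureSpinorAlgebra.
Variables (F : numFieldType) (n N : nat).
Variables (x : 'I_n -> 'I_N -> F) (K : 'I_N -> 'I_n -> F).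
Hypothesis x_null : forall A B, \sum_a x a A * x a B = 0.
Hypothesis x_split : forall a b,
  \sum_A x a A * K A b + \sum_A x b A * K A a = (a == b)%:R.

(* As [x] is null, [x_split] forces [prj] to be idempotent: it is the projection
   onto the span of [x] along a totally null complement. *)
Definition prj a b := \sum_A x a A * K A b.

Definition on_null (f : 'I_n -> F) := forall A, \sum_a x a A * f a = 0.

Lemma on_null_prjl f b : on_null f -> \sum_a prj a b * f a = 0.
Proof.
move=> fN; under eq_bigr do rewrite mulr_suml.
rewrite exchange_big big1 // => A _.
transitivity (K A b * \sum_a x a A * f a); last by rewrite fN mulr0.
by rewrite mulr_sumr; apply: eq_bigr => a _; ring.
Qed.

Lemma sum_delta (f : 'I_n -> F) a : \sum_b (a == b)%:R * f b = f a.
Proof.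
rewrite (bigD1 a) //= eqxx mul1r big1 ?addr0 // => b.
by rewrite eq_sym => /negPf ->; rewrite mul0r.
Qed.

Lemma sum_deltar (f : 'I_n -> F) a : \sum_b f b * (b == a)%:R = f a.
Proof. by rewrite -[RHS]sum_delta; apply: eq_bigr => b _; rewrite mulrC eq_sym. Qed.

Lemma on_null_prjr f a : on_null f -> \sum_b prj a b * f b = f a.
Proof.
move=> fN; rewrite -[RHS]sum_delta; under [RHS]eq_bigr do rewrite -x_split mulrDl.
by rewrite big_split /= [X in _ + X](on_null_prjl a fN) addr0.
Qed.

(** Inserting delta = P + P^T turns a metric trace into contractions with [prj], where nullity on N
    can be used. *)
Lemma sum_trace (f : 'I_n -> 'I_n -> F) :
  \sum_a f a a = \sum_a \sum_b prj a b * (f a b + f b a).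
Proof.
transitivity (\sum_a \sum_b (a == b)%:R * f a b).
  by apply: eq_bigr => a _; rewrite sum_delta.
under eq_bigr do under eq_bigr do rewrite -x_split mulrDl.
under eq_bigr do rewrite big_split /=.
rewrite big_split /= [X in _ + X]exchange_big /= -big_split /=.
apply: eq_bigr => a _; rewrite -big_split /=; apply: eq_bigr => b _.
by rewrite mulrDr.
Qed.

Lemma on_null_x B : on_null (fun a => x a B).
Proof. by move=> A; exact: x_null. Qed.

(** * Two-forms contracted with the bivector of a pure spinor *)

Section TwoForms.
Variables (xi : 'I_N -> F) (x2 : 'I_n -> 'I_n -> 'I_N -> F).
Hypothesis x2N : forall a b C, x2 a b C = - x2 b a C.
Hypothesis x_x2 : forall A e C, \sum_a x a A * x2 a e C = x e A * xi C.

(** In matrix form the bivector [S] is skew with X^T S = xi_C X^T, so expanding it by P + P^T = 1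
    gives xi_C (P^T - P) + P S P^T. The last summand lies in N tensor N, where f vanishes. *)
Lemma pure_two_form f C :
  (forall A B, \sum_a \sum_b x a A * x b B * f a b = 0) ->
  \sum_a \sum_b x2 a b C * f a b =
    xi C * \sum_a \sum_b (prj b a - prj a b) * f a b.
Proof.
move=> fN.
pose X : 'M[F]_(n, N) := \matrix_(a, A) x a A; pose k : 'M[F]_(N, n) := \matrix_(A, a) K A a.
pose P := X *m k; pose S : 'M[F]_n := \matrix_(a, b) x2 a b C.
pose f' : 'M[F]_n := \matrix_(a, b) f a b.
have PE a b : P a b = prj a b by rewrite mxE; apply: eq_bigr => A _; rewrite !mxE.
have XX : X^T *m X = 0.
  apply/matrixP => A B; rewrite !mxE -[RHS](x_null A B).
  by apply: eq_bigr => a _; rewrite !mxE.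
have PP : P + P^T = 1%:M.
  by apply/matrixP => a b; rewrite [LHS]mxE [P^T _ _]mxE !PE x_split mxE.
have XS : X^T *m S = xi C *: X^T.
  apply/matrixP => A e; rewrite !mxE mulrC -x_x2.
  by apply: eq_bigr => a _; rewrite !mxE.
have ST : S^T = - S by apply/matrixP => a b; rewrite !mxE x2N.
have SX : S *m X = - (xi C *: X).
  by apply: trmx_inj; rewrite trmx_mul ST mulmxN XS -!scalerN [RHS]linearZ /= [(- X)^T]linearN.
have XfX : X^T *m f' *m X = 0.
  apply/matrixP => A B; rewrite !mxE -[RHS](fN A B) exchange_big /=.
  apply: eq_bigr => b _; rewrite !mxE mulr_suml; apply: eq_bigr => a _.
  by rewrite !mxE mulrAC.
have PTP : P^T *m P = 0.
  by rewrite /P trmx_mul -mulmxA (mulmxA X^T) XX mul0mx mulmx0.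
have PPP : P *m P = P by rewrite -[RHS]mul1mx -PP mulmxDl PTP addr0.
(* S = P^T S + P S P + P S P^T, where P^T S = xi_C P^T and P S P = - xi_C P. *)
have SE : S = xi C *: (P^T - P) + P *m S *m P^T.
  have PTS : P^T *m S = xi C *: P^T by rewrite trmx_mul -mulmxA XS -scalemxAr.
  have PSP : P *m S *m P = - (xi C *: P).
    by rewrite -mulmxA {2}/P (mulmxA S) SX mulNmx mulmxN -scalemxAl -scalemxAr -/P PPP.
  rewrite -[LHS]mul1mx -PP mulmxDl PTS -[X in X + _]mulmx1 -PP mulmxDr PSP.
  by rewrite scalerBr [LHS]addrC addrA.
have trE (A B : 'M[F]_n) : \tr (A^T *m B) = \sum_a \sum_b A a b * B a b.
  rewrite /mxtrace exchange_big /=; apply: eq_bigr => b _; rewrite mxE.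
  by apply: eq_bigr => a _; rewrite mxE.
transitivity (\tr (S^T *m f')).
  by rewrite trE; apply: eq_bigr => a _; apply: eq_bigr => b _; rewrite !mxE.
rewrite {1}SE linearD /= mulmxDl linearD /= linearZ /= -scalemxAl linearZ /=.
rewrite [X in _ + X](_ : _ = 0) ?addr0.
  congr (_ * _); rewrite trE; apply: eq_bigr => a _; apply: eq_bigr => b _.
  by rewrite [f' _ _]mxE 2![in LHS]mxE [(- P) _ _]mxE !PE.
rewrite !trmx_mul trmxK -!mulmxA mxtrace_mulC -!mulmxA.
by rewrite (mulmxA X^T) XfX !mulmx0 mxtrace0.
Qed.

Lemma pure_two_form0 f C : (forall a b, f a b = - f b a) ->
  (forall b, on_null (fun a => f a b)) -> \sum_a \sum_b x2 a b C * f a b = 0.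
Proof.
move=> fN fx.
have P0 : \sum_a \sum_b prj a b * f a b = 0.
  by rewrite exchange_big big1 //= => b _; rewrite on_null_prjl.
rewrite pure_two_form => [|A B].
  under eq_bigr do under eq_bigr do rewrite mulrBl.
  under eq_bigr do rewrite sumrB.
  rewrite sumrB P0 subr0 exchange_big /=.
  under eq_bigr do under eq_bigr do rewrite fN mulrN.
  under eq_bigr do rewrite sumrN.
  by rewrite sumrN P0 oppr0 mulr0.
rewrite exchange_big big1 //= => b _.
transitivity (x b B * \sum_a x a A * f a b); last by rewrite fx mulr0.
by rewrite mulr_sumr; apply: eq_bigr => a _; ring.
Qed.

(** With its first pair contracted with x, T is a 2-form annihilated by N in one slot; then even the
    [prj]-trace in [pure_two_form] vanishes. *)
Lemma triple_two_form T C : (forall a b c d, T a b c d = - T a b d c) ->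
  (forall A B D d, \sum_a \sum_b \sum_c x a A * x b B * x c D * T a b c d = 0) ->
  forall A B, \sum_a \sum_b \sum_c \sum_d x a A * x b B * x2 c d C * T a b c d = 0.
Proof.
move=> T34 tr A B; pose f c d := \sum_a \sum_b x a A * x b B * T a b c d.
transitivity (\sum_c \sum_d x2 c d C * f c d).
  under eq_bigr do rewrite exchange_big /=.
  rewrite exchange_big /=; apply: eq_bigr => c _.
  under eq_bigr do rewrite exchange_big /=.
  rewrite exchange_big /=; apply: eq_bigr => d _; rewrite mulr_sumr.
  apply: eq_bigr => a _; rewrite mulr_sumr; apply: eq_bigr => b _; ring.
apply: pure_two_form0 => [c d|d D].
  rewrite /f -sumrN; apply: eq_bigr => a _; rewrite -sumrN.
  by apply: eq_bigr => b _; rewrite T34 mulrN.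
rewrite -[RHS](tr A B D d); under eq_bigr do rewrite mulr_sumr.
rewrite exchange_big /=; apply: eq_bigr => a _.
under eq_bigr do rewrite mulr_sumr.
rewrite exchange_big /=; apply: eq_bigr => b _; apply: eq_bigr => c _; ring.
Qed.

End TwoForms.

End PureSpinorAlgebra.

(** * Curvature tensors vanishing on a totally null subspace *)

Section Curvature.
Variables (F : numFieldType) (n N : nat).
Variables (x : 'I_n -> 'I_N -> F) (K : 'I_N -> 'I_n -> F).
Hypothesis x_null : forall A B, \sum_a x a A * x a B = 0.
Hypothesis x_split : forall a b,
  \sum_A x a A * K A b + \sum_A x b A * K A a = (a == b)%:R.
Local Notation prj := (prj x K).
Local Notation on_null := (on_null x).
Local Notation dlt a b := ((a == b)%:R : F).
Local Notation nn := (n%:R : F).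

Variable T : 'I_n -> 'I_n -> 'I_n -> 'I_n -> F.
Hypothesis T12 : forall a b c d, T a b c d = - T b a c d.
Hypothesis T34 : forall a b c d, T a b c d = - T a b d c.
Hypothesis Tpair : forall a b c d, T a b c d = T c d a b.
Hypothesis Tcyc : forall a b c d, T a b c d + T b c a d + T c a b d = 0.
Hypothesis TN : forall A B c d, \sum_a \sum_b x a A * x b B * T a b c d = 0.

(* The derived tensors are variables with defining equations, over an abstract
   field: [ring] and [field] do not terminate on the concrete complex numbers. *)
Variables (Ric Phi : 'I_n -> 'I_n -> F) (Rs : F) (W : 'I_n -> 'I_n -> 'I_n -> 'I_n -> F).
Hypothesis RicE : forall a b, Ric a b = \sum_c T a c b c.
Hypothesis RsE : Rs = \sum_a Ric a a.
Hypothesis PhiE : forall a b, Phi a b = Ric a b - Rs / nn * dlt a b.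
Hypothesis WE : forall a b c d, W a b c d = T a b c d
  - 4 / (nn - 2) * (4^-1 * (Phi c a * dlt b d - Phi c b * dlt a d
               - Phi d a * dlt b c + Phi d b * dlt a c))
  - 2 / (nn * (nn - 1)) * Rs * (2^-1 * (dlt c a * dlt b d - dlt c b * dlt a d)).
Hypothesis n4 : (4 < n)%N.

Lemma natr_sub_neq0 k : (k <= 4)%N -> nn - k%:R != 0.
Proof.
move=> k4; rewrite subr_eq0 eqr_nat; apply: contraTneq n4 => ->.
by rewrite -leqNgt.
Qed.

Lemma natr_dim_neq0 : nn != 0. Proof. by rewrite -[nn]subr0; exact: (natr_sub_neq0 (k := 0)). Qed.

Lemma Ric_sym a b : Ric a b = Ric b a.
Proof. by rewrite !RicE; apply: eq_bigr => c _; rewrite Tpair. Qed.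

Lemma Phi_sym a b : Phi a b = Phi b a.
Proof. by rewrite !PhiE Ric_sym eq_sym. Qed.

Lemma Phi_trace : \sum_a Phi a a = 0.
Proof.
under eq_bigr do rewrite PhiE eqxx mulr1.
rewrite big_split /= -RsE sumrN sumr_const card_ord.
by rewrite -[Rs / nn *+ n]mulr_natr divfK ?subrr // natr_dim_neq0.
Qed.

Definition contrT A b c d := \sum_a x a A * T a b c d.
Definition contrRic A b := \sum_a x a A * Ric a b.
Definition contrPhi A b := \sum_a x a A * Phi a b.
Definition contrW A a e b := \sum_d x d A * W a e d b.

Lemma contrT_null A c d : on_null (fun b => contrT A b c d).
Proof.
move=> B; rewrite -[RHS](TN A B c d) exchange_big /=; apply: eq_bigr => b _.
by rewrite mulr_sumr; apply: eq_bigr => a _; ring.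
Qed.

(** The other half of the trace has vectors of N in both slots of the first pair, where [T]
    vanishes. *)
Lemma contrRicE A b : contrRic A b = \sum_c \sum_d prj c d * contrT A d b c.
Proof.
transitivity (\sum_c contrT A c b c).
  rewrite exchange_big /=; apply: eq_bigr => a _.
  by rewrite RicE mulr_sumr.
rewrite (sum_trace x_split (fun c d => contrT A c b d)).
under eq_bigr do under eq_bigr do rewrite mulrDr.
under eq_bigr do rewrite big_split /=.
rewrite big_split /= exchange_big /= [X in X + _]big1 ?add0r // => d _.
by rewrite on_null_prjl //; exact: contrT_null.
Qed.

(** After [contrRicE] both slots of the last pair carry vectors of N, namely x and the first index
    of [prj]; pair symmetry reduces this to [TN]. *)
Lemma contrRic_null A : on_null (contrRic A).
Proof.
move=> B; under eq_bigr do rewrite contrRicE mulr_sumr.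
rewrite exchange_big /= ; under eq_bigr do under eq_bigr do rewrite mulr_sumr.
under eq_bigr do rewrite exchange_big /=.
rewrite exchange_big big1 //= => d _.
transitivity (\sum_a x a A * \sum_c prj c d * contrT B c a d).
  under [RHS]eq_bigr do rewrite mulr_sumr.
  rewrite [RHS]exchange_big /=; apply: eq_bigr => c _.
  under eq_bigr do rewrite mulr_sumr mulr_sumr.
  under [RHS]eq_bigr do rewrite mulr_sumr mulr_sumr.
  rewrite exchange_big /=; apply: eq_bigr => a _; apply: eq_bigr => b _.
  by rewrite (Tpair a); ring.
by rewrite big1 // => a _; rewrite on_null_prjl ?mulr0 //; exact: contrT_null.
Qed.

Lemma sum_x_delta A b : \sum_a x a A * dlt a b = x b A.
Proof. by rewrite sum_deltar. Qed.

Lemma contrPhiE A b : contrPhi A b = contrRic A b - Rs / nn * x b A.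
Proof.
rewrite -sum_x_delta mulr_sumr -sumrB; apply: eq_bigr => a _.
by rewrite PhiE; ring.
Qed.

Lemma contrPhi_null A : on_null (contrPhi A).
Proof.
move=> B; under eq_bigr do rewrite contrPhiE mulrBr.
rewrite sumrB contrRic_null sub0r.
transitivity (- (Rs / nn * \sum_a x a B * x a A)); last by rewrite x_null mulr0 oppr0.
by rewrite mulr_sumr; congr (- _); apply: eq_bigr => a _; ring.
Qed.

(** In the cyclic sum over a, e, d, the term T d a e b has d and a in N and vanishes, while T e d a
    b is the Ricci term in the form of [contrRicE]. *)
Lemma prj_contrT A b : \sum_a \sum_e prj a e * \sum_d x d A * T a e d b = - contrRic A b.
Proof.
have E : \sum_a \sum_e prj a e * contrT A a e b = 0.
  by rewrite exchange_big big1 //= => e _; rewrite on_null_prjl //; exact: contrT_null.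
apply/eqP; rewrite -addr_eq0 contrRicE -[X in _ + X]addr0 -[X in _ + (_ + X)]E -!big_split /=.
apply/eqP/big1 => a _ /=; rewrite -!big_split /=; apply: big1 => e _ /=.
rewrite -!mulrDr /contrT -!big_split big1 ?mulr0 //= => d _.
rewrite -!mulrDr (T34 d e b a) (T12 d e) opprK.
by rewrite addrA Tcyc mulr0.
Qed.

Lemma contrWE A a e b : contrW A a e b = \sum_d x d A * T a e d b
  - (nn - 2)^-1 * (contrPhi A a * dlt e b - contrPhi A e * dlt a b
                   - Phi b a * x e A + Phi b e * x a A)
  - Rs / (nn * (nn - 1)) * (x a A * dlt e b - x e A * dlt a b).
Proof.
rewrite -(sum_x_delta A a) -(sum_x_delta A e) /contrPhi.
rewrite !mulr_suml !mulr_sumr -!sumrB -big_split /= !mulr_sumr -!sumrB.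
apply: eq_bigr => d _; rewrite WE (Phi_sym b a) (Phi_sym b e) (eq_sym e d) (eq_sym a d).
have N2 := natr_sub_neq0 (k := 2) isT; have N1 := natr_sub_neq0 (k := 1) isT.
rewrite (Phi_sym a b) (Phi_sym e b).
by field; rewrite N2 N1 natr_dim_neq0.
Qed.

Lemma weyl12 a b c d : W a b c d = - W b a c d.
Proof.
rewrite !WE (T12 a b).
by rewrite (eq_sym c a) (eq_sym c b); ring.
Qed.

Lemma weyl34 a b c d : W a b c d = - W a b d c.
Proof. by rewrite !WE (T34 a b) (eq_sym c a) (eq_sym c b) (eq_sym d a) (eq_sym d b); ring. Qed.

(** Each correction term of [contrWE] acquires a factor g or Phi evaluated on N x N, and both vanish
    there; the remaining term is [T] on N x N. *)
Lemma contrW_null A B D b : \sum_a \sum_e x a A * x e B * contrW D a e b = 0.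
Proof.
transitivity (\sum_d x d D * (\sum_a \sum_e x a A * x e B * T a e d b)
  - (nn - 2)^-1 * ((\sum_a x a A * contrPhi D a) * x b B - x b A * (\sum_e x e B * contrPhi D e)
     - (\sum_a x a A * Phi b a) * (\sum_e x e B * x e D)
     + (\sum_a x a A * x a D) * (\sum_e x e B * Phi b e))
  - Rs / (nn * (nn - 1)) * ((\sum_a x a A * x a D) * x b B - x b A * (\sum_e x e B * x e D))); last first.
  rewrite !contrPhi_null !x_null !mul0r !mulr0 !subr0 addr0 !mulr0 !subr0.
  by rewrite big1 // => d _; rewrite TN mulr0.
have E1 : \sum_d x d D * (\sum_a \sum_e x a A * x e B * T a e d b) =
    \sum_a \sum_e x a A * x e B * \sum_d x d D * T a e d b.
  under eq_bigr do rewrite mulr_sumr.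
  rewrite exchange_big /=; apply: eq_bigr => a _.
  under eq_bigr do rewrite mulr_sumr.
  rewrite exchange_big /=; apply: eq_bigr => e _.
  by rewrite mulr_sumr; apply: eq_bigr => d _; ring.
have E (f g : 'I_n -> F) : (\sum_a f a) * (\sum_e g e) = \sum_a \sum_e f a * g e.
  by rewrite mulr_suml; apply: eq_bigr => a _; rewrite mulr_sumr.
have vE a e := contrWE D a e b; move: (contrPhi D) vE => p vE.
rewrite E1 -(sum_x_delta B b) -(sum_x_delta A b) !E.
rewrite -!sumrB -big_split /= !mulr_sumr -!sumrB; apply: eq_bigr => a _.
rewrite -!sumrB -big_split /= !mulr_sumr -!sumrB; apply: eq_bigr => e _.
by rewrite vE; ring.
Qed.

(** The value of P^{ae} C_{aedb} xi^{dA}. The coefficient of Phi is -1 from the Ricci term plus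
    2/(n-2) from the trace correction; that of R is -1/n + 1/(n(n-1)). *)
Definition weyl_trace A b :=
  - ((nn - 4) / (nn - 2)) * contrPhi A b - (nn - 2) / (nn * (nn - 1)) * Rs * x b A.

Lemma prj_contrW A b : \sum_a \sum_e prj a e * contrW A a e b = weyl_trace A b.
Proof.
transitivity (\sum_a \sum_e prj a e * (\sum_d x d A * T a e d b)
  - (nn - 2)^-1 * ((\sum_a prj a b * contrPhi A a) - (\sum_e prj b e * contrPhi A e)
     - (\sum_a (\sum_e prj a e * x e A) * Phi b a)
     + (\sum_e (\sum_a prj a e * x a A) * Phi b e))
  - Rs / (nn * (nn - 1)) * ((\sum_a prj a b * x a A) - (\sum_e prj b e * x e A))).
  have vE a e := contrWE A a e b; move: (contrPhi A) vE => p vE.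
  rewrite -(sum_deltar (fun e => \sum_a prj a e * p a) b).
  rewrite -(sum_deltar (fun e => \sum_a prj a e * x a A) b).
  rewrite -(sum_deltar (fun a => \sum_e prj a e * p e) b).
  rewrite -(sum_deltar (fun a => \sum_e prj a e * x e A) b).
  have E (f : 'I_n -> 'I_n -> F) (g : 'I_n -> F) :
      \sum_e (\sum_a f a e) * g e = \sum_a \sum_e f a e * g e.
    by rewrite exchange_big /=; apply: eq_bigr => e _; rewrite mulr_suml.
  have E' (f : 'I_n -> 'I_n -> F) (g : 'I_n -> F) :
      \sum_a (\sum_e f a e) * g a = \sum_a \sum_e f a e * g a.
    by apply: eq_bigr => e _; rewrite mulr_suml.
  rewrite (E (fun a e => prj a e * p a)) (E (fun a e => prj a e * x a A)).
  rewrite (E (fun a e => prj a e * x a A)).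
  rewrite (E' (fun a e => prj a e * p e)) (E' (fun a e => prj a e * x e A)).
  rewrite (E' (fun a e => prj a e * x e A)).
  rewrite -!sumrB -big_split /= !mulr_sumr -!sumrB; apply: eq_bigr => a _.
  rewrite -!sumrB -big_split /= !mulr_sumr -!sumrB; apply: eq_bigr => e _.
  by rewrite vE; ring.
have xN := on_null_x x_null A.
rewrite prj_contrT (on_null_prjl _ b (contrPhi_null A)) (on_null_prjr x_split b (contrPhi_null A)).
rewrite (on_null_prjl _ b xN) (on_null_prjr x_split b xN).
have -> : \sum_e (\sum_a prj a e * x a A) * Phi b e = 0.
  by apply: big1 => e _; rewrite (on_null_prjl _ e xN) mul0r.
have -> : \sum_a (\sum_e prj a e * x e A) * Phi b a = contrPhi A b.
  by apply: eq_bigr => a _; rewrite (on_null_prjr x_split a xN) Phi_sym.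
rewrite /weyl_trace (_ : contrRic A b = contrPhi A b + Rs / nn * x b A); last by rewrite contrPhiE subrK.
have N2 := natr_sub_neq0 (k := 2) isT; have N1 := natr_sub_neq0 (k := 1) isT.
by field; rewrite N2 N1 natr_dim_neq0.
Qed.

Lemma contrW_swap A a e b : contrW A a e b = - contrW A e a b.
Proof. by rewrite /contrW -sumrN; apply: eq_bigr => d _; rewrite weyl12 mulrN. Qed.

Lemma weyl_trace_null A : on_null (weyl_trace A).
Proof.
move=> B; rewrite /weyl_trace; under eq_bigr do rewrite mulrBr mulrCA [X in _ - X]mulrCA.
by rewrite sumrB -!mulr_sumr contrPhi_null x_null !mulr0 subr0.
Qed.

Lemma prj_skew f : (forall a b, f a b = - f b a) ->
  \sum_a \sum_b (prj b a - prj a b) * f a b = - 2 * \sum_a \sum_b prj a b * f a b.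
Proof.
move=> fN; rewrite mulNr mulr_natl mulr2n opprD.
rewrite -[X in _ = X - _]sumrN -sumrB.
rewrite [X in _ = X](_ : _ = \sum_a \sum_b (- (prj b a * f b a) - prj a b * f a b)).
  by apply: eq_bigr => a _; apply: eq_bigr => b _; rewrite (fN b a); ring.
under [RHS]eq_bigr do rewrite sumrB sumrN.
by rewrite !sumrB; congr (_ - _); rewrite !sumrN exchange_big.
Qed.

Lemma prj_diag a : prj a a = 2^-1.
Proof.
have := x_split a a; rewrite eqxx -/(prj a a) -mulr2n => E.
have two0 : (2 : F) != 0 by rewrite pnatr_eq0.
by apply: (mulIf two0); rewrite mulVf // mulr_natr E.
Qed.

(** The contraction of P with the symmetric Phi is half the trace of Phi, hence 0, and P has trace
    n/2; only the scalar curvature survives. *)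
Lemma prj_weyl_trace : \sum_d \sum_A K A d * weyl_trace A d = - (nn - 2) / (2 * (nn - 1)) * Rs.
Proof.
have E (y : 'I_n -> 'I_n -> F) : \sum_d \sum_A K A d * (\sum_a x a A * y a d) =
    \sum_a \sum_d prj a d * y a d.
  rewrite [RHS]exchange_big /=; apply: eq_bigr => d _.
  under eq_bigr do rewrite mulr_sumr.
  rewrite exchange_big /=; apply: eq_bigr => a _; rewrite mulr_suml.
  by apply: eq_bigr => A _; ring.
have P0 : \sum_a \sum_d prj a d * Phi a d = 0.
  have := Phi_trace; rewrite (sum_trace x_split).
  rewrite [LHS](_ : _ = 2 * \sum_a \sum_d prj a d * Phi a d).
    by move/eqP; rewrite mulf_eq0 pnatr_eq0 => /eqP.
  rewrite mulr_sumr; apply: eq_bigr => a _; rewrite mulr_sumr.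
  by apply: eq_bigr => d _; rewrite (Phi_sym d a); ring.
have P1 : \sum_d \sum_A K A d * x d A = nn / 2.
  transitivity (\sum_(d < n) (2^-1 : F)); last by rewrite sumr_const card_ord mulr_natl.
  by apply: eq_bigr => d _; rewrite -(prj_diag d); apply: eq_bigr => A _; rewrite mulrC.
transitivity (- ((nn - 4) / (nn - 2)) * (\sum_d \sum_A K A d * contrPhi A d)
   - (nn - 2) / (nn * (nn - 1)) * Rs * (\sum_d \sum_A K A d * x d A)).
  rewrite !mulr_sumr -sumrB; apply: eq_bigr => d _.
  by rewrite !mulr_sumr -sumrB; apply: eq_bigr => A _; rewrite /weyl_trace; ring.
rewrite E P0 P1.
have N2 := natr_sub_neq0 (k := 2) isT; have N1 := natr_sub_neq0 (k := 1) isT.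
by field; rewrite N1 natr_dim_neq0.
Qed.

Lemma Phi_null_null A B : \sum_a \sum_b x a A * x b B * Phi a b = 0.
Proof.
rewrite -[RHS](contrPhi_null A B) exchange_big /=; apply: eq_bigr => b _.
by rewrite mulr_sumr; apply: eq_bigr => a _; ring.
Qed.

Lemma weyl_null_triple A B D d : \sum_a \sum_b \sum_c x a A * x b B * x c D * W a b c d = 0.
Proof.
rewrite -[RHS](contrW_null A B D d); apply: eq_bigr => a _; apply: eq_bigr => b _.
by rewrite mulr_sumr; apply: eq_bigr => c _; rewrite mulrA.
Qed.

(** * Contractions of the Weyl tensor with the pure spinor *)

Variables (xi : 'I_N -> F) (x2 : 'I_n -> 'I_n -> 'I_N -> F) (gam : 'I_n -> 'I_N -> 'I_N -> F).
Hypothesis x2N : forall a b C, x2 a b C = - x2 b a C.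
Hypothesis x_x2 : forall A e C, \sum_a x a A * x2 a e C = x e A * xi C.
Hypothesis xi_gam : forall e D, \sum_D' xi D' * gam e D' D = x e D.

Lemma x2_contrW A b C : \sum_a \sum_e x2 a e C * contrW A a e b = - 2 * xi C * weyl_trace A b.
Proof.
rewrite (pure_two_form x_null x_split x2N x_x2); last first.
  by move=> B D; exact: contrW_null.
by rewrite prj_skew ?prj_contrW; [ring|exact: (fun a e => contrW_swap A a e b)].
Qed.

(** [pure_two_form] applies a second time: by [weyl_trace_null] the once contracted tensor [G]
    vanishes on N x N as well. The constant is (-2)(-2) times that of [prj_weyl_trace]. *)
Lemma x2_x2_W C D :
  \sum_a \sum_b \sum_c \sum_d x2 a b C * x2 c d D * W a b c d =
  - (2 * (nn - 2) / (nn - 1) * Rs) * xi C * xi D.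
Proof.
pose G c d := \sum_a \sum_b x2 a b C * W a b c d.
have xG A d : \sum_c x c A * G c d = - 2 * xi C * weyl_trace A d.
  rewrite -x2_contrW; under eq_bigr do rewrite mulr_sumr.
  rewrite exchange_big /=; apply: eq_bigr => a _.
  under eq_bigr do rewrite mulr_sumr.
  rewrite exchange_big /=; apply: eq_bigr => b _.
  by rewrite mulr_sumr; apply: eq_bigr => c _; ring.
transitivity (\sum_c \sum_d x2 c d D * G c d).
  under eq_bigr do rewrite exchange_big /=.
  rewrite exchange_big /=; apply: eq_bigr => c _.
  under eq_bigr do rewrite exchange_big /=.
  rewrite exchange_big /=; apply: eq_bigr => d _; rewrite mulr_sumr.
  apply: eq_bigr => a _; rewrite mulr_sumr; apply: eq_bigr => b _; ring.
rewrite (pure_two_form x_null x_split x2N x_x2); last first.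
  move=> A B; transitivity (\sum_d x d B * \sum_c x c A * G c d).
    rewrite exchange_big /=; apply: eq_bigr => d _; rewrite mulr_sumr.
    by apply: eq_bigr => c _; ring.
  under eq_bigr do rewrite xG mulrCA.
  by rewrite -mulr_sumr weyl_trace_null mulr0.
rewrite prj_skew; last first.
  move=> c d; rewrite /G -sumrN; apply: eq_bigr => a _; rewrite -sumrN.
  by apply: eq_bigr => b _; rewrite weyl34 mulrN.
have -> : \sum_c \sum_d prj c d * G c d = \sum_d \sum_A K A d * \sum_c x c A * G c d.
  rewrite exchange_big /=; apply: eq_bigr => d _.
  under [RHS]eq_bigr do rewrite mulr_sumr.
  rewrite [RHS]exchange_big /=; apply: eq_bigr => c _; rewrite mulr_suml.
  by apply: eq_bigr => A _; ring.
under eq_bigr do under eq_bigr do rewrite xG mulrCA.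
under eq_bigr do rewrite -mulr_sumr.
rewrite -mulr_sumr prj_weyl_trace.
by field; rewrite (natr_sub_neq0 (k := 1)).
Qed.

Lemma x2_x_W C D d :
  \sum_a \sum_b \sum_c x2 a b C * x c D * W a b c d = - 2 * xi C * weyl_trace D d.
Proof.
rewrite -x2_contrW; apply: eq_bigr => a _; apply: eq_bigr => b _.
by rewrite mulr_sumr; apply: eq_bigr => c _; rewrite mulrA.
Qed.

(** The correction with 1/n cancels exactly the scalar curvature part of [weyl_trace], which leaves
    the tracefree Ricci part alone. *)
Lemma PiC_1_0_formula C D d :
  (\sum_a \sum_b \sum_c x2 a b C * x c D * W a b c d)
  + nn^-1 * (\sum_D' (\sum_a \sum_b \sum_c \sum_e x2 a b C * x2 c e D' * W a b c e)
                      * gam d D' D)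
  = 2 * (nn - 4) / (nn - 2) * xi C * contrPhi D d.
Proof.
rewrite x2_x_W.
rewrite (eq_bigr (fun D' => - (2 * (nn - 2) / (nn - 1) * Rs) * xi C * (xi D' * gam d D' D))).
  rewrite -mulr_sumr xi_gam /weyl_trace.
  have N2 := natr_sub_neq0 (k := 2) isT; have N1 := natr_sub_neq0 (k := 1) isT.
  by field; rewrite N1 N2 natr_dim_neq0.
by move=> D' _; rewrite x2_x2_W mulrA.
Qed.

(** By the cyclic identity and pair symmetry, T_{abcd} - T_{acbd} = - T_{adbc}, which vanishes for a
    and d in N. Only the Ricci corrections of [W] contribute. *)
Lemma weyl_null_skew A D b c :
  (\sum_a \sum_d x a A * W a b c d * x d D) - (\sum_a \sum_d x a A * W a c b d * x d D) =
  - (nn - 2)^-1 * (contrPhi A c * x b D + contrPhi D b * x c A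
                  - contrPhi A b * x c D - contrPhi D c * x b A)
  - Rs / (nn * (nn - 1)) * (x c A * x b D - x b A * x c D).
Proof.
have T0 : \sum_a \sum_d x a A * x d D * (T a b c d - T a c b d) = 0.
  transitivity (- \sum_a \sum_d x a A * x d D * T a d b c); last by rewrite TN oppr0.
  rewrite -sumrN; apply: eq_bigr => a _.
  rewrite -sumrN; apply: eq_bigr => d _; rewrite -mulrN; congr (_ * _).
  rewrite (Tpair a d) (T12 a c) opprK; apply/eqP; rewrite -addr_eq0; apply/eqP.
  by rewrite -[RHS](Tcyc a b c d); ring.
have xd E e : x e E = \sum_a x a E * dlt a e by rewrite sum_x_delta.
have E (f g : 'I_n -> F) : (\sum_a f a) * (\sum_e g e) = \sum_a \sum_e f a * g e.
  by rewrite mulr_suml; apply: eq_bigr => a _; rewrite mulr_sumr.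
rewrite (mulrC (contrPhi D b)) (mulrC (contrPhi D c)).
rewrite -[LHS]subr0 -[X in _ - _ - X = _]T0 /contrPhi (xd D b) (xd D c) (xd A b) (xd A c).
rewrite !E -!sumrB -!big_split -!sumrB /= !mulr_sumr -!sumrB; apply: eq_bigr => a _.
rewrite -!sumrB -!big_split -!sumrB /= !mulr_sumr -!sumrB; apply: eq_bigr => d _.
rewrite !WE (Phi_sym c a) (Phi_sym c b) (Phi_sym b a) (eq_sym b d) (eq_sym c d).
rewrite (eq_sym c a) (eq_sym b a) (eq_sym c b).
have N2 := natr_sub_neq0 (k := 2) isT; have N1 := natr_sub_neq0 (k := 1) isT.
by field; rewrite N1 N2 natr_dim_neq0.
Qed.

Lemma x2_gam_W A D b c :
  \sum_a \sum_e \sum_d \sum_C' x2 a e C' * W a e d b * gam c C' A * x d D =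
  x c A * (- 2 * weyl_trace D b).
Proof.
rewrite -xi_gam mulr_suml.
transitivity (\sum_C' gam c C' A * \sum_a \sum_e x2 a e C' * contrW D a e b); last first.
  by apply: eq_bigr => C' _; rewrite x2_contrW; ring.
under [RHS]eq_bigr do rewrite mulr_sumr.
rewrite [RHS]exchange_big /=; apply: eq_bigr => a _.
under [RHS]eq_bigr do rewrite mulr_sumr.
rewrite [RHS]exchange_big /=; apply: eq_bigr => e _.
under [RHS]eq_bigr do rewrite mulr_sumr mulr_sumr.
rewrite [RHS]exchange_big /=; apply: eq_bigr => d _.
by apply: eq_bigr => C' _; ring.
Qed.

Lemma x2_gam_x2_gam_W A D b c :
  \sum_a \sum_e \sum_d \sum_f \sum_C' \sum_F'
    x2 a e C' * W a e d f * x2 d f F' * gam b C' A * gam c F' D =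
  - (2 * (nn - 2) / (nn - 1) * Rs) * x b A * x c D.
Proof.
rewrite -(xi_gam b) -(xi_gam c) -mulrA mulr_suml mulr_sumr.
under [RHS]eq_bigr do rewrite !mulr_sumr.
transitivity (\sum_C' \sum_F' gam b C' A * gam c F' D *
    \sum_a \sum_e \sum_d \sum_f x2 a e C' * x2 d f F' * W a e d f); last first.
  by apply: eq_bigr => C' _; apply: eq_bigr => F' _; rewrite x2_x2_W; ring.
under [RHS]eq_bigr do under eq_bigr do rewrite mulr_sumr.
under [RHS]eq_bigr do rewrite exchange_big /=.
rewrite [RHS]exchange_big /=; apply: eq_bigr => a _.
under [RHS]eq_bigr do under eq_bigr do rewrite mulr_sumr.
under [RHS]eq_bigr do rewrite exchange_big /=.
rewrite [RHS]exchange_big /=; apply: eq_bigr => e _.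
under [RHS]eq_bigr do under eq_bigr do rewrite mulr_sumr.
under [RHS]eq_bigr do rewrite exchange_big /=.
rewrite [RHS]exchange_big /=; apply: eq_bigr => d _.
under [RHS]eq_bigr do under eq_bigr do rewrite mulr_sumr.
under [RHS]eq_bigr do rewrite exchange_big /=.
rewrite [RHS]exchange_big /=; apply: eq_bigr => f _.
by apply: eq_bigr => C' _; apply: eq_bigr => F' _; ring.
Qed.

(** All three terms are combinations of contrPhi with x and of R x x, skew in b and c. The term with
    1/(n-4) cancels the Phi part of the first one, and the last term balances the scalar parts of
    both. *)
Lemma PiC_2_0_vanish A D b c
    (fst := fun A D b c => \sum_a \sum_d x a A * W a b c d * x d D)
    (snd := fun A D b c => \sum_a \sum_e \sum_d \sum_C'
       x2 a e C' * W a e d b * gam c C' A * x d D)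
    (trd := fun A D b c => \sum_a \sum_e \sum_d \sum_f \sum_C' \sum_F'
       x2 a e C' * W a e d f * x2 d f F' * gam b C' A * gam c F' D) :
  2^-1 * (fst A D b c - fst A D c b)
  + (nn - 4)^-1 * (4^-1 * (snd A D b c - snd A D c b - snd D A b c + snd D A c b))
  - (2 * (nn - 2) * (nn - 4))^-1 * (2^-1 * (trd A D b c - trd A D c b)) = 0.
Proof.
rewrite /fst /snd /trd weyl_null_skew !x2_gam_W !x2_gam_x2_gam_W /weyl_trace.
have N2 := natr_sub_neq0 (k := 2) isT; have N1 := natr_sub_neq0 (k := 1) isT.
have N4 := natr_sub_neq0 (k := 4) isT.
by field; rewrite N1 N2 N4 natr_dim_neq0.
Qed.

End Curvature.

(** * Pure spinors and their null subspaces *)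

Section NullSubspaces.
Variable F : numFieldType.

(** The rows of Q^T are dual to those of [B]; subtracting half of their Gram matrix Q^T Q times [B]
    makes them null and keeps the duality, because the rows of [B] are null. *)
Lemma null_dual_basis n r (B : 'M[F]_(r, n)) : n = (r + r)%N -> row_free B ->
  B *m B^T = 0 -> exists B', B^T *m B' + B'^T *m B = 1%:M.
Proof.
move=> nr /row_freeP[Q BQ] BB; subst n.
have QB : Q^T *m B^T = 1%:M by rewrite -trmx_mul BQ trmx1.
pose B' := Q^T - 2^-1 *: (Q^T *m Q *m B); exists B'.
have B'B : B' *m B^T = 1%:M.
  by rewrite /B' mulmxBl QB -scalemxAl -(mulmxA _ B) BB mulmx0 scaler0 subr0.
have BB' : B *m B'^T = 1%:M by rewrite -[LHS]trmxK trmx_mul trmxK B'B trmx1.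
have B'B' : B' *m B'^T = 0.
  rewrite {1}/B' mulmxBl -scalemxAl -(mulmxA _ B) BB' mulmx1.
  rewrite /B' linearB /= mulmxBr trmxK linearZ /= -scalemxAr trmx_mul mulmxA QB mul1mx.
  rewrite trmx_mul trmxK -addrA -opprD -scalerDl.
  by rewrite (_ : 2^-1 + 2^-1 = 1 :> F) ?scale1r ?subrr //; field.
(* The pairings say E (E^T J) = 1. As E is square, the factors commute, and the reversed product is
   the completeness relation. *)
pose E := col_mx B B'; pose J : 'M[F]_(r + r) := block_mx 0 1%:M 1%:M 0.
have EJ : E *m (E^T *m J) = 1%:M.
  rewrite mulmxA /E tr_col_mx mul_col_row BB BB' B'B B'B' mulmx_block.
  by rewrite !mulmx0 !mul0mx !mulmx1 !addr0 !add0r -scalar_mx_block.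
have := mulmx1C EJ; rewrite /E tr_col_mx mul_row_block !mulmx0 !mulmx1 add0r addr0.
by rewrite mul_row_col addrC.
Qed.

(** A null kernel of half the dimension is its own orthogonal complement. The columns of [X] are
    orthogonal to the kernel, hence lie in it, and by rank they span it. *)
Lemma null_kernel_split n m N (X : 'M[F]_(n, N)) : n = (m + m)%N ->
  \rank (kermx X) = m -> kermx X *m (kermx X)^T = 0 ->
  X^T *m X = 0 /\ exists K, X *m K + (X *m K)^T = 1%:M.
Proof.
move=> nm rk kk.
have rX : \rank X^T = m.
  by rewrite mxrank_tr -(addnK m (\rank X)) -{1}rk mxrank_ker subnKC ?rank_leq_row // nm addnK.
have k1 : (kermx X <= kermx (kermx X)^T)%MS by apply/sub_kermxP.
have k2 : (kermx (kermx X)^T <= kermx X)%MS.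
  by rewrite -(geq_leqif (mxrank_leqif_sup k1)) mxrank_ker mxrank_tr rk nm addnK.
have /submxP[D XD] : (X^T <= kermx X)%MS.
  apply: submx_trans k2; apply/sub_kermxP.
  by rewrite -trmx_mul mulmx_ker trmx0.
have XX : X^T *m X = 0 by rewrite XD -mulmxA mulmx_ker mulmx0.
split=> //.
have /submxP[L BL] : (row_base X^T <= X^T)%MS by rewrite eq_row_base.
have BB : row_base X^T *m (row_base X^T)^T = 0.
  by rewrite {}BL trmx_mul trmxK -mulmxA (mulmxA X^T) XX mul0mx mulmx0.
have [|B' BB'] := null_dual_basis _ (row_base_free X^T) BB; first by rewrite rX.
have BT : (row_base X^T)^T = X *m L^T by rewrite {1}BL trmx_mul trmxK.
exists (L^T *m B'); rewrite mulmxA -BT -BB'; congr (_ + _).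
by rewrite trmx_mul trmxK.
Qed.

End NullSubspaces.

(** * Vectors annihilating a spinor under Clifford multiplication *)

Section CliffordKernel.
Variables (F : numFieldType) (n N : nat) (gP gM : 'I_n -> 'M[F]_N).
Hypothesis gPM : forall a b, gP a *m gM b + gP b *m gM a = - (2 * (a == b)%:R)%:M.
Variable xi : 'rV[F]_N.

Let X := \matrix_(a, A) (xi *m gP a) 0 A.

Lemma clifford_kernel_slash (u : 'rV[F]_n) : u *m X = xi *m (\sum_a u 0 a *: gP a).
Proof.
apply/rowP => A; rewrite mulmx_sumr summxE mxE; apply: eq_bigr => a _.
by rewrite [X a A]mxE -scalemxAr [RHS]mxE.
Qed.

Lemma clifford_slashM (u v : 'rV[F]_n) :
  (\sum_a u 0 a *: gP a) *m (\sum_b v 0 b *: gM b) +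
  (\sum_a v 0 a *: gP a) *m (\sum_b u 0 b *: gM b) = - (2 * (u *m v^T) 0 0)%:M.
Proof.
have E (y z : 'rV[F]_n) : (\sum_a y 0 a *: gP a) *m (\sum_b z 0 b *: gM b) =
    \sum_a \sum_b (y 0 a * z 0 b) *: (gP a *m gM b).
  rewrite mulmx_suml; apply: eq_bigr => a _; rewrite mulmx_sumr.
  by apply: eq_bigr => b _; rewrite -scalemxAl -scalemxAr scalerA.
rewrite !E [X in _ + X]exchange_big /= -big_split /= mxE mulr_sumr.
rewrite -scalemx1 scaler_suml -sumrN; apply: eq_bigr => a _.
rewrite -big_split /= (bigD1 a) //= big1 => [|b /negPf ba].
  rewrite addr0 (mulrC (v 0 a)) -scalerDr gPM eqxx mulr1 mxE -scalemx1 scalerN scalerA.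
  by congr (- (_ *: _)); rewrite mulrC.
by rewrite (mulrC (v 0 b)) -scalerDr gPM eq_sym ba mulr0 -scalemx1 scale0r oppr0 scaler0.
Qed.

(** The products of u and v in either order kill [xi], so the Clifford relation leaves g(u,v) xi =
    0. *)
Lemma clifford_kernel_null (u v : 'rV[F]_n) : xi != 0 ->
  u *m X = 0 -> v *m X = 0 -> u *m v^T = 0.
Proof.
move=> xi0; rewrite !clifford_kernel_slash => u0 v0.
have /eqP : xi *m - (2 * (u *m v^T) 0 0)%:M = 0.
  by rewrite -clifford_slashM mulmxDr !mulmxA u0 v0 !mul0mx addr0.
rewrite mulmxN mul_mx_scalar oppr_eq0 scaler_eq0 (negPf xi0) orbF mulf_eq0 pnatr_eq0 /=.
by move=> /eqP uv0; apply/matrixP => i j; rewrite !ord1 uv0 mxE.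
Qed.

Lemma pure_kernel_split m : n = (m + m)%N -> xi != 0 -> \rank (kermx X) = m ->
  X^T *m X = 0 /\ exists K, X *m K + (X *m K)^T = 1%:M.
Proof.
move=> nm xi0 rk; apply: null_kernel_split nm rk _.
apply/matrixP => i j; rewrite [RHS]mxE.
have kX l : row l (kermx X) *m X = 0 by rewrite -row_mul mulmx_ker row0.
have := clifford_kernel_null xi0 (kX i) (kX j).
move=> /matrixP/(_ 0 0); rewrite [RHS]mxE => <-.
by rewrite !mxE; apply: eq_bigr => k _; rewrite !mxE.
Qed.

(** A column u of [X] annihilates [xi]. Of the two orders of multiplication one therefore drops out,
    and the other is a multiple of [xi] by the Clifford relation; the factor 2 cancels the
    normalisation. *)
Lemma pure_contract_bivector A e C : X^T *m X = 0 ->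
  \sum_a (xi *m gP a) 0 A *
     (xi *m (2^-1 *: (gP a *m gM e - gP e *m gM a))) 0 C = (xi *m gP e) 0 A * xi 0 C.
Proof.
move=> XX; pose u := row A X^T.
have uX : u *m X = 0 by rewrite -row_mul XX row0.
have uE a : u 0 a = (xi *m gP a) 0 A by rewrite !mxE.
pose U := \sum_a u 0 a *: gM a.
have xu : xi *m (\sum_a u 0 a *: gP a) = 0 by rewrite -clifford_kernel_slash.
transitivity ((xi *m (2^-1 *: ((\sum_a u 0 a *: gP a) *m gM e - gP e *m U))) 0 C).
  rewrite mulmx_suml mulmx_sumr -sumrB scaler_sumr mulmx_sumr summxE.
  apply: eq_bigr => a _; rewrite -uE -(scalemxAl _ (gP a)) -(scalemxAr _ (gP e)) -scalerBr.
  by rewrite scalerA (mulrC 2^-1) -scalerA -[in RHS](scalemxAr _ xi) [RHS]mxE.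
have -> : gP e *m U = - (2 * u 0 e)%:M - (\sum_a u 0 a *: gP a) *m gM e.
  apply/eqP; rewrite -subr_eq opprK; apply/eqP.
  have := clifford_slashM (delta_mx 0 e) u.
  have D (g : 'I_n -> 'M[F]_N) : \sum_a (delta_mx 0 e : 'rV[F]_n) 0 a *: g a = g e.
    rewrite (bigD1 e) //= mxE !eqxx scale1r big1 ?addr0 // => a /negPf ae.
    by rewrite mxE ae andbF scale0r.
  rewrite !D => ->; congr (- (2 * _)%:M).
  by rewrite -rowE !mxE.
rewrite -scalemxAr mulmxBr mulmxBr !mulmxA xu mul0mx subr0 sub0r.
rewrite mulmxN opprK mul_mx_scalar scalerA mulrA mulVf ?pnatr_eq0 // mul1r.
by rewrite mxE uE.
Qed.

End CliffordKernel.

(** * Second derivatives of holomorphic functions *)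

Section MeanValue.
Local Open Scope classical_set_scope.
Local Open Scope ring_scope.
Local Open Scope complex_scope.
Variable R : realType.
Local Notation C := (Cplx R).
Local Notation toC := (fun x : R => x%:C : C).

Lemma cplx_ge_Re (z : C) : (`|complex.Re z|%:C : C) <= `|z|.
Proof. exact: normc_ge_Re. Qed.

Lemma normNi : `|- 'i%C : C| = 1.
Proof. by rewrite normrN normc_def /= expr0n expr1n add0r sqrtr1. Qed.

Lemma norm_toC (x : R) : `|toC x| = toC `|x|.
Proof. by rewrite normc_def /= expr0n addr0 sqrtr_sqr. Qed.

Lemma cplx_le_ReIm (z : C) :
  `|z| <= ((`|complex.Re z| + `|complex.Im z|)%:C : C).
Proof.
rewrite rmorphD /= {1}(complexE z).
apply: (le_trans (ler_normD _ _)); rewrite normrM.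
suff -> : `|'i%C : C| = 1 by rewrite mul1r !norm_toC.
by rewrite normc_def /= expr0n expr1n add0r sqrtr1.
Qed.

Lemma ReB (x y : C) : complex.Re (x - y) = complex.Re x - complex.Re y.
Proof. by case: x y => [a b] [c d]. Qed.

Lemma ReM (h : R) (y : C) : complex.Re (toC h * y) = h * complex.Re y.
Proof. by case: y => [c d] /=; rewrite mul0r subr0. Qed.

Lemma ReNi (z : C) : complex.Re (- 'i%C * z : C) = complex.Im z.
Proof. by case: z => a b /=; rewrite oppr0 mul0r sub0r mulN1r opprK. Qed.

(** Restricting a complex function to the real line, and then to its real part, opens the way to the
    real mean value theorem. *)
Lemma is_derive_Re (f : C -> C) (t : R) : derivable f (toC t) 1 ->
  is_derive t 1 (fun s => complex.Re (f (toC s))) (complex.Re ('D_1 f (toC t))).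
Proof.
move=> df.
have cv : (fun h : R => h^-1 *: (((fun s => complex.Re (f (toC s))) \o shift t) (h *: 1)
     - complex.Re (f (toC t)))) @ 0^' --> complex.Re ('D_1 f (toC t)).
  apply/cvgrPdist_lt => e e0.
  have e0' : 0 < toC e by rewrite ltcR.
  have /cvgrPdist_lt/(_ _ e0') := df.
  rewrite /within /= => /nbhs_ballP [d /= d0 H].
  have dr : d = toC (complex.Re d).
    by rewrite RRe_real // gtr0_real.
  rewrite dr ltcR in d0 H.
  apply/nbhs_ballP; exists (complex.Re d) => //= h hd h0.
  have := H (toC h); rewrite /ball /= !sub0r !normrN norm_toC ltcR.
  move=> /(_ _)/wrap[]; first by move: hd; rewrite /ball /= sub0r normrN.
  move=> /(_ _)/wrap[]; first by rewrite fmorph_eq0.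
  move=> K; rewrite -ltcR; apply: le_lt_trans K; apply: le_trans (cplx_ge_Re _).
  rewrite lecR le_eqVlt; apply/orP; left; apply/eqP; congr (`| _ |).
  rewrite ReB; congr (_ - _).
  rewrite /GRing.scale /= !mulr1 -fmorphV ReM ReB; congr (_ * (complex.Re (f _) - _)).
  by rewrite rmorphD.
split; first by apply/cvg_ex; eexists; exact: cv.
exact/cvg_lim.
Qed.

Lemma Re_mean_value (f : C -> C) (L e : C) :
  (forall t, 0 <= t <= 1 -> derivable f (toC t) 1) ->
  (forall t, 0 <= t <= 1 -> `|'D_1 f (toC t) - L| <= e) ->
  toC `|complex.Re (f 1 - f 0 - L)| <= e.
Proof.
move=> df bf.
have [t t01 E] : exists2 t : R, t \in `[0, 1] & complex.Re (f (toC 1)) - complex.Re (f (toC 0)) =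
    complex.Re ('D_1 f (toC t)) * (1 - 0).
  apply: (@MVT_segment R (fun s => complex.Re (f (toC s)))) => //.
    by move=> t /itvP t01; apply/is_derive_Re/df; rewrite !t01.
  apply: derivable_within_continuous => t /itvP t01.
  by have [] := is_derive_Re (df t _); rewrite ?t01.
have -> : complex.Re (f 1 - f 0 - L) = complex.Re ('D_1 f (toC t) - L).
  by rewrite !ReB -[complex.Re (f 1) - _]/(complex.Re (f (toC 1)) - complex.Re (f (toC 0))) E subr0 mulr1.
apply: le_trans (cplx_ge_Re _) (bf _ _).
by rewrite !(itvP t01).
Qed.

(* The factor 2 replaces the vector-valued mean value inequality by the real
   one for the real and the imaginary part. *)
Lemma cplx_mean_value (f : C -> C) (L e : C) :
  (forall t, 0 <= t <= 1 -> derivable f (toC t) 1) ->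
  (forall t, 0 <= t <= 1 -> `|'D_1 f (toC t) - L| <= e) ->
  `|f 1 - f 0 - L| <= 2 * e.
Proof.
move=> df bf; apply: le_trans (cplx_le_ReIm _) _.
rewrite rmorphD /= mulr_natl mulr2n; apply: lerD; first exact: Re_mean_value.
rewrite -ReNi !mulrBr.
apply: (@Re_mean_value (fun x : C => (- 'i%C : C) * f x)) => t t01.
  exact/derivableZ/df.
have -> : 'D_1 (fun x : C => (- 'i%C : C) * f x) (toC t) = (- 'i%C : C) * 'D_1 f (toC t).
  exact: (deriveZ _ (df t t01)).
by rewrite -mulrBr normrM normNi mul1r bf.
Qed.

End MeanValue.

Lemma sub_sub_cancel (F : comPzRingType) (a b c x y : F) :
  (a - b - (x - y) = (a - c - x) - (b - c - y))%R.
Proof. by ring. Qed.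

Lemma sub_sub_swap (F : comPzRingType) (a b c d x y h : F) :
  (h ^+ 2 * (x - y) = (a - b - (c - d) - h ^+ 2 * y) - (a - c - (b - d) - h ^+ 2 * x))%R.
Proof. by ring. Qed.

Section SecondDerivatives.
Local Open Scope classical_set_scope.
Local Open Scope ring_scope.
Variables (R : realType) (n : nat).
Local Notation C := (Cplx R).
Local Notation V := 'rV[C]_n.

Lemma is_derive_line (f : V -> C) (p u : V) (t : C) :
  derivable f (t *: u + p) u ->
  is_derive t 1 (fun s => f (s *: u + p)) ('D_u f (t *: u + p)).
Proof.
move=> df.
have E : (fun h : C => h^-1 *: (((fun s => f (s *: u + p)) \o shift t) (h *: 1)
     - f (t *: u + p))) = (fun h => h^-1 *: ((f \o shift (t *: u + p)) (h *: u) - f (t *: u + p))).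
  apply/funext => h /=; congr (_ *: (f _ - _)).
  by rewrite addrA -scalerDl /GRing.scale /= mulr1.
by split; rewrite ?/derivable ?/derive E.
Qed.

Lemma derivable_diff_bound (G : V -> C) (z : V) (e : C) : differentiable G z -> 0 < e ->
  exists2 d : C, 0 < d & forall k, `|k| < d ->
    `|G (k + z) - G z - 'd G z k| <= e * `|k|.
Proof.
move=> dG e0.
have /eqaddoP/(_ e e0) := diff_locally dG.
move=> /nbhs_ballP [d /= d0 H]; exists d => // k kd.
have := H k; rewrite -ball_normE /= sub0r normrN => /(_ kd).
by rewrite -[X in `|X|]/(G (k + z) - (G z + 'd G z k)) opprD addrA.
Qed.

(** The mean value inequality along v bounds the second difference by values of ['D_v f], and the
    first-order expansion of ['D_v f] at the single point z does the rest. In C, [0 < h] makes h a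
    positive real. *)
Lemma derive_second_difference (A : set V) (f : V -> C) (v w z : V) (e : C) :
  open A -> A z -> (forall y, A y -> differentiable f y) ->
  differentiable ('D_v f) z -> 0 < e ->
  exists2 d : C, 0 < d & forall h : C, 0 < h -> h < d ->
    `|(f (h *: v + (h *: w + z)) - f (h *: v + z)) - (f (h *: w + z) - f z)
      - h ^+ 2 * 'D_w ('D_v f) z| <= 2 * (e * h ^+ 2).
Proof.
move=> oA Az dfA dG e0.
set G := 'D_v f.
(* Displacements a h v + b h w with a, b in [0, 1] have norm at most h K; the summand 1 makes K
   positive. The tolerance e / (2 K) below is spent twice, on the edges b = 0 and b = 1. *)
pose K : C := `|v| + `|w| + 1.
have K0 : 0 < K by rewrite ltr_wpDl// addr_ge0.
have [d1 d10 H1] := derivable_diff_bound dG (divr_gt0 e0 (mulr_gt0 (ltr0Sn C 1) K0)).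
have /nbhs_ballP [r /= r0 Hr] : nbhs z A by exact: open_nbhs_nbhs.
pose d := Order.min d1 r.
(* The order of C is partial, but positive elements are real and so comparable. *)
have cmp : d1 >=< r by rewrite real_comparable // gtr0_real.
have d0 : 0 < d by rewrite comparable_lt_min // d10 r0.
exists (d / K); first exact: divr_gt0.
move=> h h0 hd.
have hK : h * K < d by rewrite -ltr_pdivlMr.
have small (a b : C) : 0 <= a <= 1 -> 0 <= b <= 1 ->
    `|(a * h) *: v + (b * h) *: w| <= h * K.
  move=> /andP[a0 a1] /andP[b0 b1].
  apply: (le_trans (ler_normD _ _)); rewrite !normrZ ?normrM (gtr0_norm h0).
  rewrite (ger0_norm a0) (ger0_norm b0) /K !mulrDr mulr1 -addrA.
  apply: lerD; first by rewrite ler_wpM2r // ler_piMl // ltW.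
  rewrite -[X in X <= _]addr0; apply: lerD; last exact: ltW.
  by rewrite ler_wpM2r // ler_piMl // ltW.
have tcomp (t : R) : 0 <= t <= 1 -> 0 <= (t%:C%C : C) <= 1.
  by rewrite ler0c -(lecR t 1).
have smallA (t : R) (b : C) : 0 <= t <= 1 -> 0 <= b <= 1 ->
    A ((t%:C%C : C) *: (h *: v) + ((b * h) *: w + z)).
  move=> /tcomp t01 b01; apply: Hr; rewrite -ball_normE /= addrA opprD addrCA subrr addr0 normrN scalerA.
  apply: le_lt_trans (small _ _ t01 b01) _; apply: lt_le_trans hK _.
  by rewrite comparable_ge_min // lexx orbT.
have dv (t : R) b : 0 <= t <= 1 -> 0 <= b <= 1 ->
    is_derive (t%:C%C : C) (1 : C) (fun s : C => f (s *: (h *: v) + ((b * h) *: w + z)))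
       (h * G ((t%:C%C : C) *: (h *: v) + ((b * h) *: w + z))).
  move=> t01 b01; have D := dfA _ (smallA t b t01 b01).
  have -> : h * G ((t%:C%C : C) *: (h *: v) + ((b * h) *: w + z)) =
      'D_(h *: v) f ((t%:C%C : C) *: (h *: v) + ((b * h) *: w + z)).
    rewrite /G; rewrite deriveE; last exact: D.
    rewrite [RHS]deriveE; last exact: D.
    by rewrite [RHS]linearZ.
  exact/(@is_derive_line f ((b * h) *: w + z) (h *: v))/diff_derivable.
(* The increment of [phi] from 0 to 1 is the second difference; the factors 1 and 0 are kept so that
   [dv] serves both edges. *)
pose phi s := f (s *: (h *: v) + ((1 * h) *: w + z)) - f (s *: (h *: v) + ((0 * h) *: w + z)).
have dphi (t : R) : 0 <= t <= 1 -> is_derive (t%:C%C : C) (1 : C) phi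
   (h * G ((t%:C%C : C) *: (h *: v) + ((1 * h) *: w + z))
    - h * G ((t%:C%C : C) *: (h *: v) + ((0 * h) *: w + z))).
  by move=> t01; apply: is_deriveB; apply: dv; rewrite ?ler01 ?lexx.
have -> : f (h *: v + (h *: w + z)) - f (h *: v + z) - (f (h *: w + z) - f z) = phi 1 - phi 0.
  by rewrite /phi !scale1r !mul0r !scale0r !mul1r !add0r.
apply: (@cplx_mean_value _ phi) => t t01; first by case: (dphi t t01).
have -> := @derive_val _ _ _ _ _ _ _ (dphi t t01).
set T : C := t%:C%C.
have T01 : 0 <= T <= 1 by exact: tcomp.
pose k b : V := (T * h) *: v + (b * h) *: w.
have kE b : T *: (h *: v) + ((b * h) *: w + z) = k b + z by rewrite addrA scalerA.
have kb b : 0 <= b <= 1 -> `|G (k b + z) - G z - 'd G z (k b)| <= e / (2 * K) * (h * K).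
  move=> b01; have kK := small _ _ T01 b01.
  apply: le_trans (H1 _ _) _.
    by apply: le_lt_trans kK (lt_le_trans hK _); rewrite comparable_ge_min // lexx.
  by rewrite ler_wpM2l // divr_ge0 // ?mulr_ge0 // ltW.
rewrite !kE deriveE // expr2 -mulrA -!mulrBr normrM (gtr0_norm h0) -/G.
have -> : e * (h * h) = h * (e / (2 * K) * (h * K) + e / (2 * K) * (h * K)).
  by field; rewrite gt_eqF.
apply: ler_wpM2l; first exact: ltW.
have -> : G (k 1 + z) - G (k 0 + z) - h * 'd G z w =
  (G (k 1 + z) - G z - 'd G z (k 1)) - (G (k 0 + z) - G z - 'd G z (k 0)).
  have -> : h * 'd G z w = 'd G z (k 1) - 'd G z (k 0).
    rewrite -linearB /k mul0r scale0r addr0 addrAC subrr add0r mul1r.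
    by rewrite [RHS]linearZ.
  exact: sub_sub_cancel.
apply: le_trans (ler_normB _ _) _; apply: lerD; apply: kb; rewrite ?ler01 ?lexx //.
Qed.

(** The second difference is symmetric in v and w, so both iterated derivatives approximate the same
    quantity after division by h^2. *)
Lemma derive_comm (A : set V) (f : V -> C) (v w z : V) :
  open A -> A z -> (forall y, A y -> differentiable f y) ->
  differentiable ('D_v f) z -> differentiable ('D_w f) z ->
  'D_w ('D_v f) z = 'D_v ('D_w f) z.
Proof.
move=> oA Az dfA dv dw; apply/eqP; rewrite -subr_eq0 -normr_eq0.
set D := _ - _.
have : forall e : C, 0 < e -> `|D| <= 4 * e.
  move=> e e0.
  have [d1 d10 H1] := derive_second_difference w oA Az dfA dv e0.
  have [d2 d20 H2] := derive_second_difference v oA Az dfA dw e0.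
  have cmp : d1 >=< d2 by rewrite real_comparable // gtr0_real.
  pose h := Order.min d1 d2 / 2.
  have m0 : 0 < Order.min d1 d2 by rewrite comparable_lt_min // d10 d20.
  have h0 : 0 < h by rewrite divr_gt0.
  have hm : h < Order.min d1 d2 by rewrite ltr_pdivrMr // ltr_pMr // ltr1n.
  have hd1 : h < d1 by apply: lt_le_trans hm _; rewrite comparable_ge_min // lexx.
  have hd2 : h < d2 by apply: lt_le_trans hm _; rewrite comparable_ge_min // lexx orbT.
  have {}H1 := H1 h h0 hd1; have {}H2 := H2 h h0 hd2.
  have h2 : 0 < h ^+ 2 by rewrite exprn_gt0.
  rewrite -(ler_pM2l h2) -{1}(gtr0_norm h2) -normrM.
  have -> : h ^+ 2 * (4 * e) = 2 * (e * h ^+ 2) + 2 * (e * h ^+ 2) by ring.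
  apply: le_trans (lerD H2 H1); rewrite [h *: w + (h *: v + z)]addrCA.
  apply: le_trans (ler_normB _ _); rewrite le_eqVlt; apply/orP; left; apply/eqP.
  by congr (`| _ |); exact: sub_sub_swap.
move=> H; rewrite eq_le normr_ge0 andbT.
have [->|D0] := eqVneq D 0; first by rewrite normr0.
have D0' : 0 < `|D| by rewrite normr_gt0.
(* With e = |D| / 8 the bound reads |D| <= |D| / 2. *)
have := H (`|D| / 8) (divr_gt0 D0' (ltr0Sn _ _)).
have -> : 4 * (`|D| / 8) = `|D| / 2 by field.
by rewrite ler_pdivlMr // ger_pMr // -subr_le0 addrK ler10.
Qed.

End SecondDerivatives.

(** * Holomorphic calculus of matrix-valued functions *)

(* Locked: otherwise unification unfolds derivatives of entries down to limits. *)
HB.lock Definition mD (R : realType) (n p q : nat) (a : 'I_n)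
    (F : 'rV[Cplx R]_n -> 'M[Cplx R]_(p, q)) (z : 'rV[Cplx R]_n) : 'M[Cplx R]_(p, q) :=
  (\matrix_(i, j) pd a (fun w => F w i j) z)%R.

Section HolomorphicCalculus.
Local Open Scope classical_set_scope.
Local Open Scope ring_scope.
Variables (R : realType) (n : nat) (A : set 'rV[Cplx R]_n).
Hypothesis oA : open A.
Local Notation C := (Cplx R).
Local Notation V := 'rV[C]_n.
Implicit Types (f g : V -> C) (a b : 'I_n) (z : V).

Lemma near_open f g z : {in A, f =1 g} -> A z -> \near z, f z = g z.
Proof.
move=> fg Az; have : nbhs z A by exact: open_nbhs_nbhs.
by apply: filterS => y Ay; apply: fg; rewrite inE.
Qed.

Lemma pd_ext a f g z : {in A, f =1 g} -> A z -> pd a f z = pd a g z.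
Proof. by move=> fg Az; apply/near_eq_derive/near_open. Qed.

Lemma differentiable_ext f g z : {in A, f =1 g} -> A z ->
  differentiable f z -> differentiable g z.
Proof.
move=> fg Az df; have fgz : f z = g z by apply: fg; rewrite inE.
have [cf ef] := (diff_locallyP z f).1 df.
have eg : g \o shift z = cst (g z) + 'd f z +o_ (0 : V) id.
  apply/eqaddoP => e e0; move/eqaddoP: ef => /(_ e e0).
  have N : \forall k \near (0 : V), f (k + z) = g (k + z).
    by have := near_open fg Az; rewrite (near_shift 0) /= subr0; apply: filterS.
  rewrite -fgz; apply: filterS2 N => k /=.
  by rewrite /= !fctE /= => ->.
have E := diff_unique cf eg.
apply/diff_locallyP.
exact: (eq_ind_r (fun d : V -> C => continuous d /\
  g \o shift z = cst (g z) + d +o_ (0 : V) id) (conj cf eg) E).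
Qed.

(** Needed because the rules of differentiation hold on [A] only, whereas [cdiff] differentiates
    total functions. *)
Lemma cdiff_ext k f g : {in A, f =1 g} -> cdiff k A f -> cdiff k A g.
Proof.
elim: k f g => [//|k IH] f g fg /= [df H]; split.
  by move=> z Az; apply: differentiable_ext fg Az (df z Az).
move=> a; apply: IH (H a) => z /set_mem Az; exact: pd_ext.
Qed.

Lemma holo_ext f g : {in A, f =1 g} -> holomorphic A f -> holomorphic A g.
Proof. by move=> fg hf k; apply: cdiff_ext fg (hf k). Qed.

Lemma holo_diff f z : holomorphic A f -> A z -> differentiable f z.
Proof. by move=> hf; have [] := hf 1%N; auto. Qed.

Lemma holo_derivable f z v : holomorphic A f -> A z -> derivable f z v.
Proof. by move=> hf Az; exact/diff_derivable/holo_diff. Qed.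

Lemma holo_pd a f : holomorphic A f -> holomorphic A (pd a f).
Proof. by move=> hf k; exact: ((hf k.+1).2 a). Qed.

Lemma pd_comm a b f z : holomorphic A f -> A z ->
  pd a (pd b f) z = pd b (pd a f) z.
Proof.
move=> hf Az; rewrite /pd.
exact: (derive_comm oA Az (fun y => @holo_diff f y hf)
  (holo_diff (holo_pd b hf) Az) (holo_diff (holo_pd a hf) Az)).
Qed.

Lemma pd_cst a (c : C) z : pd a (fun=> c) z = 0.
Proof. exact: derive_cst. Qed.

Lemma cdiff_cst k (c : C) : cdiff k A (fun=> c).
Proof.
elim: k c => [//|k IH] c /=; split=> [z _|a]; first exact: differentiable_cst.
have -> : pd a (fun=> c) = fun=> 0 by apply/funext => z; exact: pd_cst.
exact: IH.
Qed.

Lemma holo_cst (c : C) : holomorphic A (fun=> c).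
Proof. by move=> k; exact: cdiff_cst. Qed.

Lemma pdD a f g z : holomorphic A f -> holomorphic A g -> A z ->
  pd a (fun w => f w + g w) z = pd a f z + pd a g z.
Proof. by move=> hf hg Az; apply: deriveD; exact: holo_derivable. Qed.

Lemma pdM a f g z : holomorphic A f -> holomorphic A g -> A z ->
  pd a (fun w => f w * g w) z = pd a f z * g z + f z * pd a g z.
Proof.
move=> hf hg Az; rewrite [LHS]deriveM; try exact: holo_derivable.
by rewrite addrC; congr (_ + _); exact: mulrC.
Qed.

Lemma cdiffD k f g : cdiff k A f -> cdiff k A g -> cdiff k A (fun w => f w + g w).
Proof.
elim: k f g => [//|k IH] f g /= [df Hf] [dg Hg]; split.
  by move=> z Az; apply: differentiableD; [exact: df|exact: dg].
move=> a; apply: cdiff_ext (IH _ _ (Hf a) (Hg a)) => z /set_mem Az.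
by apply/esym/deriveD; apply: diff_derivable; [exact: df|exact: dg].
Qed.

Lemma holoD f g : holomorphic A f -> holomorphic A g ->
  holomorphic A (fun w => f w + g w).
Proof. by move=> hf hg k; exact: cdiffD. Qed.

Lemma holoM f g : holomorphic A f -> holomorphic A g ->
  holomorphic A (fun w => f w * g w).
Proof.
(* The induction keeps f and g holomorphic to all orders: the Leibniz rule mixes derivatives with
   the functions themselves. *)
move=> hf hg k; elim: k f g hf hg => [//|k IH] f g hf hg /=; split.
  by move=> z Az; apply: differentiableM; exact: holo_diff.
move=> a; have := cdiffD (IH _ _ (holo_pd a hf) hg) (IH _ _ hf (holo_pd a hg)).
by apply: cdiff_ext => z /set_mem Az; rewrite pdM.
Qed.

Lemma holoN f : holomorphic A f -> holomorphic A (fun w => - f w).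
Proof.
move=> hf; apply: holo_ext (holoM (holo_cst (-1)) hf) => z _; exact: mulN1r.
Qed.

Lemma holo_sum (I : finType) (h : I -> V -> C) : (forall i, holomorphic A (h i)) ->
  holomorphic A (fun w => \sum_i h i w).
Proof.
move=> hh; elim: (index_enum I) => [|i s IH].
  by apply: holo_ext (holo_cst 0) => z _; rewrite big_nil.
by apply: holo_ext (holoD (hh i) IH) => z _; rewrite big_cons.
Qed.

Lemma pd_sum a (I : finType) (h : I -> V -> C) z :
  (forall i, holomorphic A (h i)) -> A z ->
  pd a (fun w => \sum_i h i w) z = \sum_i pd a (h i) z.
Proof.
move=> hh Az.
suff [] : holomorphic A (fun w => \sum_i h i w) /\
  pd a (fun w => \sum_i h i w) z = \sum_i pd a (h i) z by [].
elim: (index_enum I) => [|i s [IH E]].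
  split; first by apply: holo_ext (holo_cst 0) => w _; rewrite big_nil.
  by rewrite big_nil -[RHS](pd_cst a 0 z); apply: pd_ext => // w _; rewrite big_nil.
split; first by apply: holo_ext (holoD (hh i) IH) => w _; rewrite big_cons.
by rewrite big_cons -E -(pdD a (hh i) IH Az); apply: pd_ext => // w _; rewrite big_cons.
Qed.

Lemma mDE p q a (F : V -> 'M[C]_(p, q)) z i j : mD a F z i j = pd a (fun w => F w i j) z.
Proof. by rewrite mD.unlock mxE. Qed.

Lemma mD_ext p q a (F G : V -> 'M[C]_(p, q)) z : {in A, F =1 G} -> A z ->
  mD a F z = mD a G z.
Proof.
move=> FG Az; apply/matrixP => i j; rewrite !mDE.
by apply: (pd_ext a _ Az) => w wA; rewrite (FG w wA).
Qed.

Lemma hmx_ext p q (F G : V -> 'M[C]_(p, q)) : {in A, F =1 G} ->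
  holomorphic_mx A F -> holomorphic_mx A G.
Proof. by move=> FG hF i j; apply: holo_ext (hF i j) => z /FG ->. Qed.

Lemma hmx_mD p q a (F : V -> 'M[C]_(p, q)) :
  holomorphic_mx A F -> holomorphic_mx A (mD a F).
Proof. by move=> hF i j; apply: holo_ext (holo_pd a (hF i j)) => z _; rewrite mDE. Qed.

Lemma hmx_tr p q (F : V -> 'M[C]_(p, q)) :
  holomorphic_mx A F -> holomorphic_mx A (fun w => (F w)^T).
Proof. by move=> hF i j; apply: holo_ext (hF j i) => z _; rewrite mxE. Qed.

Lemma hmxD p q (F G : V -> 'M[C]_(p, q)) :
  holomorphic_mx A F -> holomorphic_mx A G -> holomorphic_mx A (fun w => F w + G w).
Proof. by move=> hF hG i j; apply: holo_ext (holoD (hF i j) (hG i j)) => z _; rewrite mxE. Qed.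

Lemma hmx_mul p q r (F : V -> 'M[C]_(p, q)) (G : V -> 'M[C]_(q, r)) :
  holomorphic_mx A F -> holomorphic_mx A G -> holomorphic_mx A (fun w => F w *m G w).
Proof.
move=> hF hG i j; apply: holo_ext (holo_sum (fun k => holoM (hF i k) (hG k j))) => z _.
by rewrite mxE.
Qed.

Lemma mD_tr p q a (F : V -> 'M[C]_(p, q)) z : mD a (fun w => (F w)^T) z = (mD a F z)^T.
Proof.
apply/matrixP => i j; rewrite [RHS]mxE !mDE; congr (pd _ _ _); apply/funext => w.
by rewrite mxE.
Qed.

Lemma mDD p q a (F G : V -> 'M[C]_(p, q)) z :
  holomorphic_mx A F -> holomorphic_mx A G -> A z ->
  mD a (fun w => F w + G w) z = mD a F z + mD a G z.
Proof.
move=> hF hG Az; apply/matrixP => i j; rewrite [RHS]mxE !mDE -(pdD a (hF i j) (hG i j) Az).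
by apply: pd_ext => // w _; rewrite mxE.
Qed.

Lemma mDM p q r a (F : V -> 'M[C]_(p, q)) (G : V -> 'M[C]_(q, r)) z :
  holomorphic_mx A F -> holomorphic_mx A G -> A z ->
  mD a (fun w => F w *m G w) z = mD a F z *m G z + F z *m mD a G z.
Proof.
move=> hF hG Az; apply/matrixP => i j.
rewrite [RHS]mxE mDE [X in X + _]mxE [X in _ + X]mxE -big_split /=.
transitivity (pd a (fun w => \sum_k F w i k * G w k j) z).
  by apply: pd_ext => // w _; rewrite mxE.
apply: etrans (pd_sum a (fun k => holoM (hF i k) (hG k j)) Az) _.
by apply: eq_bigr => k _; rewrite !mDE; exact: pdM.
Qed.

Lemma mD_cst p q a (M : 'M[C]_(p, q)) z : mD a (fun=> M) z = 0.
Proof. by apply/matrixP => i j; rewrite mDE mxE pd_cst. Qed.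

Lemma mD_comm p q a b (F : V -> 'M[C]_(p, q)) z : holomorphic_mx A F -> A z ->
  mD a (mD b F) z = mD b (mD a F) z.
Proof.
move=> hF Az; apply/matrixP => i j; rewrite !mDE.
transitivity (pd a (pd b (fun w => F w i j)) z).
  by apply: pd_ext => // w _; rewrite mDE.
apply: etrans (pd_comm a b (hF i j) Az) _.
by apply: pd_ext => // w _; rewrite mDE.
Qed.

End HolomorphicCalculus.

(** * Levi-Civita curvature in a chart *)

Section CurvatureAlgebra.
Variables (F : fieldType) (n p : nat).

(** Here A, B stand for Gamma_a, Gamma_b and X, Y for d_a Gamma_b, d_b Gamma_a. The hypothesis is
    d_a d_b g = d_b d_a g, expanded by metric compatibility. *)
Lemma curvature_skew_alg (A B G X Y : 'M[F]_n) :
  X *m G + B *m (A *m G + G *m A^T) + ((A *m G + G *m A^T) *m B^T + G *m X^T) =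
  Y *m G + A *m (B *m G + G *m B^T) + ((B *m G + G *m B^T) *m A^T + G *m Y^T) ->
  (X - Y + B *m A - A *m B) *m G + G *m (X - Y + B *m A - A *m B)^T = 0.
Proof.
move=> /eqP; rewrite -subr_eq0 => /eqP H; rewrite -[RHS]H {H}.
have -> : (X - Y + B *m A - A *m B)^T = X^T - Y^T + A^T *m B^T - B^T *m A^T.
  by apply/matrixP => i j; rewrite -!trmx_mul !mxE.
rewrite !(mulmxBl, mulmxDl, mulmxBr, mulmxDr) !mulmxA.
move: (X *m G) (Y *m G) (B *m A *m G) (A *m B *m G) (G *m X^T) (G *m Y^T) => v1 v2 v3 v4 v5 v6.
move: (G *m A^T *m B^T) (G *m B^T *m A^T) (B *m G *m A^T) (A *m G *m B^T) => v7 v8 v9 v10.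
by apply/matrixP => i j; rewrite !mxE; ring.
Qed.

(** With Da + M A read as nabla_a M, the hypotheses are d_c of g(nabla_a M, M) = 0 and g(nabla_a M,
    nabla_c M) = 0; their difference is g(nabla_c nabla_a M, M) = 0, with derivatives along
    coordinate fields. *)
Lemma curvature_stabilizes_step (M Da Dc Dca : 'M[F]_(p, n)) (A C G X : 'M[F]_n) :
  (Dca + (Dc *m A + M *m X)) *m G *m M^T + (Da + M *m A) *m (C *m G + G *m C^T) *m M^T
    + (Da + M *m A) *m G *m Dc^T = 0 ->
  (Da + M *m A) *m G *m (Dc + M *m C)^T = 0 ->
  (Dca + (Dc *m A + M *m X) + (Da + M *m A) *m C) *m G *m M^T = 0.
Proof.
move=> H1 H2; rewrite -[RHS]subr0 -[X in _ - X]H2 -[X in X - _]H1 {H1 H2}.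
have -> : (Dc + M *m C)^T = Dc^T + C^T *m M^T.
  by rewrite -trmx_mul; apply/matrixP => i j; rewrite !mxE.
move: (Da + _) (Dca + _) => Y Z.
rewrite !(mulmxDl, mulmxDr) !mulmxA.
move: (Z *m G *m M^T) (Y *m G *m Dc^T) (Y *m G *m C^T *m M^T) (Y *m C *m G *m M^T) => v1 v2 v3 v4.
by apply/matrixP => i j; rewrite !mxE; ring.
Qed.

Lemma curvature_stabilizes_alg (M Da Dc Dca Dac : 'M[F]_(p, n)) (A C G X Y : 'M[F]_n) :
  Dca = Dac ->
  (Dca + (Dc *m A + M *m X) + (Da + M *m A) *m C) *m G *m M^T = 0 ->
  (Dac + (Da *m C + M *m Y) + (Dc + M *m C) *m A) *m G *m M^T = 0 ->
  M *m (X - Y + A *m C - C *m A) *m G *m M^T = 0.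
Proof.
move=> -> H1 H2.
suff -> : M *m (X - Y + A *m C - C *m A) =
    (Dac + (Dc *m A + M *m X) + (Da + M *m A) *m C)
    - (Dac + (Da *m C + M *m Y) + (Dc + M *m C) *m A).
  by rewrite 2!mulmxBl H1 H2 subrr.
rewrite !(mulmxBr, mulmxDr, mulmxDl) !mulmxA.
move: (Dc *m A) (M *m X) (Da *m C) (M *m A *m C) (M *m Y) (M *m C *m A) => v1 v2 v3 v4 v5 v6.
by apply/matrixP => i j; rewrite !mxE; ring.
Qed.

End CurvatureAlgebra.

(** * Curvature of a metric connection preserving a null subbundle *)

Section MetricConnection.
Local Open Scope classical_set_scope.
Local Open Scope ring_scope.
Variables (R : realType) (n : nat) (A : set 'rV[Cplx R]_n).
Hypothesis oA : open A.
Local Notation C := (Cplx R).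
Local Notation V := 'rV[C]_n.
Variables (G : V -> 'M[C]_n) (Gam : 'I_n -> V -> 'M[C]_n).
Hypothesis hG : holomorphic_mx A G.
Hypothesis hGam : forall a, holomorphic_mx A (Gam a).
Hypothesis compat : forall a z, A z -> mD a G z = Gam a z *m G z + G z *m (Gam a z)^T.

(** R_{abc}^d in row c and column d. Connection matrices act on rows from the right, whence the
    order of the products. *)
Definition curvature_mx a b z : 'M[C]_n :=
  mD a (Gam b) z - mD b (Gam a) z + Gam b z *m Gam a z - Gam a z *m Gam b z.

Lemma mD2_metric a b z : A z -> mD a (mD b G) z =
  mD a (Gam b) z *m G z + Gam b z *m (Gam a z *m G z + G z *m (Gam a z)^T)
  + ((Gam a z *m G z + G z *m (Gam a z)^T) *m (Gam b z)^T + G z *m (mD a (Gam b) z)^T).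
Proof.
move=> Az.
transitivity (mD a (fun w => Gam b w *m G w + G w *m (Gam b w)^T) z).
  by apply: (mD_ext oA a _ Az) => w /set_mem; exact: compat.
rewrite (mDD oA a (hmx_mul oA (hGam b) hG) (hmx_mul oA hG (hmx_tr oA (hGam b))) Az).
rewrite (mDM oA a (hGam b) hG Az) (mDM oA a hG (hmx_tr oA (hGam b)) Az).
by rewrite mD_tr (compat a Az).
Qed.

Lemma curvature_skew a b z : A z ->
  curvature_mx a b z *m G z + G z *m (curvature_mx a b z)^T = 0.
Proof.
move=> Az; apply: curvature_skew_alg.
exact: (etrans (esym (mD2_metric a b Az)) (etrans (mD_comm oA a b hG Az) (mD2_metric b a Az))).
Qed.

Variables (p : nat) (M : V -> 'M[C]_(p, n)).
Hypothesis hM : holomorphic_mx A M.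
Let Y a z := mD a M z + M z *m Gam a z.
Hypothesis YM : forall a z, A z -> Y a z *m G z *m (M z)^T = 0.
Hypothesis YY : forall a b z, A z -> Y a z *m G z *m (Y b z)^T = 0.

Lemma curvature_stabilizes_aux a c z : A z ->
  (mD c (mD a M) z + (mD c M z *m Gam a z + M z *m mD c (Gam a) z)
    + (mD a M z + M z *m Gam a z) *m Gam c z) *m G z *m (M z)^T = 0.
Proof.
move=> Az; apply: curvature_stabilizes_step (YY a c Az).
have hMG := hmx_mul oA hM (hGam a).
have hDM := hmx_mD oA a hM.
have hY := hmxD oA hDM hMG.
have : mD c (fun w => (mD a M w + M w *m Gam a w) *m G w *m (M w)^T) z = 0.
  rewrite -(mD_cst (p := p) (q := p) c (0 : 'M[C]_p) z).
  by apply: (mD_ext oA c _ Az) => w /set_mem; exact: YM.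
rewrite (mDM oA c (hmx_mul oA hY hG) (hmx_tr oA hM) Az) mD_tr.
rewrite (mDM oA c hY hG Az) (mDD oA c hDM hMG Az) (mDM oA c hM (hGam a) Az).
by rewrite (compat c Az) mulmxDl.
Qed.

Lemma curvature_stabilizes a c z : A z ->
  M z *m curvature_mx c a z *m G z *m (M z)^T = 0.
Proof.
move=> Az; apply: curvature_stabilizes_alg (mD_comm oA c a hM Az) _ _.
  exact: curvature_stabilizes_aux.
exact: curvature_stabilizes_aux.
Qed.

End MetricConnection.

Section MatrixInverse.
Variables (F : fieldType) (n : nat).

Lemma orthonormal_invmx (E g : 'M[F]_n) : g \in unitmx ->
  E *m g *m E^T = 1%:M -> invmx g = E^T *m E.
Proof.
move=> gU; rewrite -mulmxA => /mulmx1C; rewrite -mulmxA => H.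
by rewrite -[LHS]mulmx1 -H mulKmx.
Qed.

Lemma invmx_sym (g : 'M[F]_n) : g^T = g -> (invmx g)^T = invmx g.
Proof. by move=> gT; rewrite trmx_inv gT. Qed.

(** The pattern of the first Bianchi identity: by symmetry of the Christoffel symbols, the six
    derivative terms and the six quadratic terms cancel in pairs. *)
Lemma cyclic_sum3 (u v w a1 a2 b1 b2 c1 c2 q1 q2 r1 r2 s1 s2 : F) :
  u = a1 - a2 + (q1 - q2) -> v = b1 - b2 + (r1 - r2) -> w = c1 - c2 + (s1 - s2) ->
  a1 = c2 -> b1 = a2 -> c1 = b2 -> q1 = s2 -> r1 = q2 -> s1 = r2 -> u + v + w = 0.
Proof. by move=> -> -> -> -> -> -> -> -> ->; ring. Qed.

Lemma lowered_sum (h x y z : F) : 2 * h = 1 ->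
  h * (x + y - z) + h * (x + z - y) = x.
Proof. by move=> h2; rewrite -[RHS]mul1r -h2; ring. Qed.

Lemma swap_summands (u x y z z' : F) : z = z' -> u * (x + y - z) = u * (y + x - z').
Proof. by move=> ->; rewrite (addrC x). Qed.

Lemma entry_BDB (P Q S T : 'M[F]_n) c d p q s t :
  P c d = p -> Q c d = q -> S c d = s -> T c d = t ->
  (P - Q + S - T) c d = p - q + s - t.
Proof. by move=> <- <- <- <-; rewrite !mxE. Qed.

Lemma mulmx_entry (P Q : 'M[F]_n) c d (p q : 'I_n -> F) :
  (forall k, P c k = p k) -> (forall k, Q k d = q k) ->
  (P *m Q) c d = \sum_k q k * p k.
Proof. by move=> Pp Qq; rewrite mxE; apply: eq_bigr => k _; rewrite Pp Qq mulrC. Qed.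

Lemma entryN (P : 'M[F]_n) c d : (- P) c d = - P c d.
Proof. by rewrite mxE. Qed.

Lemma commutator_skew (P Q S T : 'M[F]_n) : P - Q + S - T = - (Q - P + T - S).
Proof. by apply/matrixP => i j; rewrite !mxE; ring. Qed.

Lemma skew_entry (P : 'M[F]_n) c d : P + P^T = 0 -> P c d = - P d c.
Proof. by move=> /eqP; rewrite addr_eq0 => /eqP PT; rewrite {1}PT !mxE. Qed.

End MatrixInverse.

(** * The Levi-Civita connection and the symmetries of its curvature *)

Section LeviCivita.
Local Open Scope classical_set_scope.
Local Open Scope ring_scope.
Variables (R : realType) (n : nat) (X : complexManifold R n).
Variables (g : holomorphicMetric X) (i : chart X).
Local Notation C := (Cplx R).
Local Notation V := 'rV[C]_n.
Local Notation A := (@img R n X i).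
Variable E : V -> 'M[C]_n.
Hypothesis hE : holomorphic_mx A E.
Hypothesis Eon : forall z, A z -> E z *m g i z *m (E z)^T = 1%:M.

Let oA : open A := @img_open _ _ X i.

Definition levi_civita a (z : V) : 'M[C]_n := \matrix_(c, d) christoffel g i d a c z.

(** Christoffel symbols of the first kind, in the row and column layout of [levi_civita]. *)
Definition christoffel_low a (z : V) : 'M[C]_n :=
  \matrix_(c, d) (2^-1 * (pd a (fun w => g i w c d) z
    + pd c (fun w => g i w a d) z - pd d (fun w => g i w a c) z)).

Lemma metric_sym z c d : A z -> g i z c d = g i z d c.
Proof. by move=> Az; rewrite -[in LHS](gmx_sym g Az) mxE. Qed.

Lemma pd_metric_sym a c d z : A z ->
  pd a (fun w => g i w c d) z = pd a (fun w => g i w d c) z.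
Proof. by move=> Az; apply: (pd_ext oA a _ Az) => w /set_mem; exact: metric_sym. Qed.

Lemma levi_civita_low a z : A z -> levi_civita a z = christoffel_low a z *m invmx (g i z).
Proof.
move=> Az; apply/matrixP => c d; rewrite [LHS]mxE [RHS]mxE.
apply: eq_bigr => e _; rewrite [christoffel_low _ _ _ _]mxE.
rewrite -[in LHS](invmx_sym (gmx_sym g Az)) [in LHS]mxE.
by rewrite -[LHS]mulrA [LHS]mulrCA [LHS]mulrC.
Qed.

Lemma levi_civita_metric a z : A z -> levi_civita a z *m g i z = christoffel_low a z.
Proof. by move=> Az; rewrite (levi_civita_low a Az) mulmxKV // (gmx_unit g Az). Qed.

Lemma levi_civita_compat a z : A z ->
  mD a (g i) z = levi_civita a z *m g i z + g i z *m (levi_civita a z)^T.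
Proof.
move=> Az; have -> : g i z *m (levi_civita a z)^T = (levi_civita a z *m g i z)^T.
  by rewrite trmx_mul (gmx_sym g Az).
rewrite (levi_civita_metric a Az); apply/matrixP => c d.
rewrite mDE [RHS]mxE [X in _ + X]mxE [X in X + _]mxE [X in _ + X]mxE.
rewrite (pd_metric_sym a d c Az).
by rewrite lowered_sum // mulfV // pnatr_eq0.
Qed.

(** The inverse metric is E^T E for the orthonormal frame [E], hence holomorphic without
    differentiating a determinant. *)
Lemma levi_civita_holo a : holomorphic_mx A (levi_civita a).
Proof.
have hL : holomorphic_mx A (christoffel_low a).
  move=> c d.
  have h b e f : holomorphic A (pd b (fun w => g i w e f)).
    exact: holo_pd (gmx_holomorphic g i e f).
  apply: (holo_ext oA) (holoM oA (holo_cst A (2^-1 : C))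
    (holoD oA (holoD oA (h a c d) (h c a d)) (holoN oA (h d a c)))) => z _.
  by rewrite mxE.
apply: (hmx_ext oA) (hmx_mul oA hL (hmx_mul oA (hmx_tr oA hE) hE)) => z /set_mem Az.
by rewrite (levi_civita_low a Az) (orthonormal_invmx (gmx_unit g Az) (Eon Az)).
Qed.

Lemma christoffel_torsion a c d z : A z -> christoffel g i d a c z = christoffel g i d c a z.
Proof.
move=> Az; rewrite /christoffel; apply: eq_bigr => e _.
exact: (swap_summands _ _ _ (pd_metric_sym e a c Az)).
Qed.

Local Notation U := (curvature_mx levi_civita).

Lemma riemann_upE a b c d z : riemann_up g i z a b c d = U a b z c d.
Proof.
have D e f : mD e (levi_civita f) z c d = pd e (christoffel g i d f c) z.
  have <- : (fun w => levi_civita f w c d) = christoffel g i d f c.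
    by apply/funext => w; rewrite mxE.
  exact: mDE.
have M e f : (levi_civita e z *m levi_civita f z) c d =
    \sum_k christoffel g i d f k z * christoffel g i k e c z.
  by apply: mulmx_entry => k; rewrite mxE.
apply: etrans (esym (entry_BDB (D a b) (D b a) (M b a) (M a b))).
by rewrite -addrA -sumrB.
Qed.

Lemma riemannE a b c d z : riemann g i z a b c d = (U a b z *m g i z) c d.
Proof. by rewrite mxE; apply: eq_bigr => e _; rewrite riemann_upE. Qed.

Lemma riemann12 a b c d z : riemann g i z a b c d = - riemann g i z b a c d.
Proof.
rewrite !riemannE -[RHS]entryN -mulNmx; congr ((_ *m _) _ _).
exact: commutator_skew.
Qed.

Lemma riemann34 a b c d z : A z -> riemann g i z a b c d = - riemann g i z a b d c.
Proof.
move=> Az; rewrite !riemannE; apply: skew_entry; rewrite trmx_mul (gmx_sym g Az).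
exact: (curvature_skew oA (gmx_holomorphic g i) levi_civita_holo
  (fun a z Az => levi_civita_compat a Az) a b Az).
Qed.

Lemma riemann_cyc a b c d z : A z ->
  riemann g i z a b c d + riemann g i z b c a d + riemann g i z c a b d = 0.
Proof.
move=> Az.
have pdt e f h k : pd e (christoffel g i f h k) z = pd e (christoffel g i f k h) z.
  by apply: (pd_ext oA e _ Az) => w /set_mem; exact: christoffel_torsion.
have sumt e f h k : \sum_l christoffel g i e f l z * christoffel g i l h k z =
    \sum_l christoffel g i e f l z * christoffel g i l k h z.
  apply: eq_bigr => l _.
    exact: (congr1 (fun y => christoffel g i e f l z * y) (christoffel_torsion h k l Az)).
have upE e f h k : riemann_up g i z e f h k =
    pd e (christoffel g i k f h) z - pd f (christoffel g i k e h) z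
    + (\sum_l christoffel g i k e l z * christoffel g i l f h z
       - \sum_l christoffel g i k f l z * christoffel g i l e h z).
  by rewrite -sumrB.
have up0 e : riemann_up g i z a b c e + riemann_up g i z b c a e + riemann_up g i z c a b e = 0.
  exact: (cyclic_sum3 (upE a b c e) (upE b c a e) (upE c a b e) (pdt _ _ _ _) (pdt _ _ _ _)
    (pdt _ _ _ _) (sumt _ _ _ _) (sumt _ _ _ _) (sumt _ _ _ _)).
rewrite /riemann -!big_split big1 //= => e _.
by rewrite -!mulrDl up0 mul0r.
Qed.

End LeviCivita.

(** * Curvature components in a frame *)

Section FrameComponents.
Variables (F : numFieldType) (n : nat) (E : 'M[F]_n).
Implicit Type T : 'I_n -> 'I_n -> 'I_n -> 'I_n -> F.

Lemma riemann_pair_sym T :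
  (forall a b c d, T a b c d = - T b a c d) ->
  (forall a b c d, T a b c d = - T a b d c) ->
  (forall a b c d, T a b c d + T b c a d + T c a b d = 0) ->
  forall a b c d, T a b c d = T c d a b.
Proof.
move=> T12 T34 Tcyc a b c d.
have H1 := Tcyc a b c d; have H2 := Tcyc b c d a.
have H3 := Tcyc c d a b; have H4 := Tcyc d a b c.
have two0 : (2 : F) != 0 by rewrite pnatr_eq0.
apply: (mulfI two0); apply/eqP; rewrite -subr_eq0; apply/eqP.
(* The four cyclic identities obtained by rotating a, b, c, d, with signs + + - -; modulo the skew
   symmetries only twice the desired difference remains. *)
transitivity ((T a b c d + T b c a d + T c a b d) + (T b c d a + T c d b a + T d b c a)
  - (T c d a b + T d a c b + T a c d b) - (T d a b c + T a b d c + T b d a c)); last first.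
  by rewrite H1 H2 H3 H4 !subr0 addr0.
rewrite (T34 b c d a) (T34 c d b a) (T34 d a c b) (T34 a b d c).
rewrite (T12 a c d b) (T34 c a d b) (T12 b d a c) (T34 d b a c).
by ring.
Qed.

Definition frame_components T a b c d :=
  \sum_a' \sum_b' \sum_c' \sum_d' E a a' * E b b' * E c c' * E d d' * T a' b' c' d'.

Lemma frame_components12 T : (forall a b c d, T a b c d = - T b a c d) ->
  forall a b c d, frame_components T a b c d = - frame_components T b a c d.
Proof.
move=> T12 a b c d; rewrite /frame_components exchange_big /= -sumrN.
apply: eq_bigr => b' _; rewrite -sumrN; apply: eq_bigr => a' _.
rewrite -sumrN; apply: eq_bigr => c' _; rewrite -sumrN; apply: eq_bigr => d' _.
by rewrite T12; ring.
Qed.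

Lemma frame_components34 T : (forall a b c d, T a b c d = - T a b d c) ->
  forall a b c d, frame_components T a b c d = - frame_components T a b d c.
Proof.
move=> T34 a b c d; rewrite /frame_components -sumrN.
apply: eq_bigr => a' _; rewrite -sumrN; apply: eq_bigr => b' _.
rewrite exchange_big /= -sumrN; apply: eq_bigr => d' _; rewrite -sumrN; apply: eq_bigr => c' _.
by rewrite T34; ring.
Qed.

Lemma frame_components_cyc T : (forall a b c d, T a b c d + T b c a d + T c a b d = 0) ->
  forall a b c d, frame_components T a b c d + frame_components T b c a d
    + frame_components T c a b d = 0.
Proof.
move=> Tcyc a b c d.
have -> : frame_components T b c a d = \sum_a' \sum_b' \sum_c' \sum_d'
    E a a' * E b b' * E c c' * E d d' * T b' c' a' d'.
  rewrite /frame_components; under eq_bigr do rewrite exchange_big.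
  rewrite exchange_big; do 4 (apply: eq_bigr => ? _); ring.
have -> : frame_components T c a b d = \sum_a' \sum_b' \sum_c' \sum_d'
    E a a' * E b b' * E c c' * E d d' * T c' a' b' d'.
  rewrite /frame_components exchange_big; apply: eq_bigr => a' _.
  rewrite exchange_big; do 3 (apply: eq_bigr => ? _); ring.
do 4 (rewrite -!big_split big1 //= => ? _).
by rewrite -!mulrDr Tcyc mulr0.
Qed.

Lemma mulmx_bilinear p q (P : 'M[F]_(n, p)) (Q : 'M[F]_(n, q)) (S : 'M[F]_n) A B :
  (P^T *m S *m Q) A B = \sum_c \sum_d P c A * Q d B * S c d.
Proof.
rewrite mxE exchange_big /=; apply: eq_bigr => d _; rewrite mxE mulr_suml.
by apply: eq_bigr => c _; rewrite mxE mulrAC.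
Qed.

Lemma frame_components_contract T N (X : 'M[F]_(n, N)) (Tm : 'I_n -> 'I_n -> 'M[F]_n) :
  (forall a b c d, T a b c d = Tm a b c d) ->
  (forall a b, X^T *m E *m Tm a b *m (X^T *m E)^T = 0) ->
  forall A B a b, \sum_c \sum_d X c A * X d B * frame_components T a b c d = 0.
Proof.
move=> TE XT A B a b.
have Z a' b' : \sum_c \sum_d X c A * X d B * \sum_c' \sum_d' E c c' * E d d' * T a' b' c' d' = 0.
  have /matrixP/(_ A B) := XT a' b'; rewrite [RHS]mxE; apply: etrans.
  rewrite (_ : _ *m _ = X^T *m (E *m Tm a' b' *m E^T) *m X); last first.
    by rewrite trmx_mul trmxK !mulmxA.
  rewrite mulmx_bilinear.
  apply: eq_bigr => c _; apply: eq_bigr => d _; congr (_ * _).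
  have := mulmx_bilinear E^T E^T (Tm a' b') c d; rewrite trmxK => ->.
  apply: eq_bigr => c' _; apply: eq_bigr => d' _.
  by rewrite TE ![E^T _ _]mxE.
transitivity (\sum_a' \sum_b' E a a' * E b b' *
  \sum_c \sum_d X c A * X d B * \sum_c' \sum_d' E c c' * E d d' * T a' b' c' d'); last first.
  by rewrite big1 // => a' _; rewrite big1 // => b' _; rewrite Z mulr0.
under [RHS]eq_bigr do under eq_bigr do rewrite mulr_sumr.
under [RHS]eq_bigr do rewrite exchange_big /=.
rewrite [RHS]exchange_big /=; apply: eq_bigr => c _.
under [RHS]eq_bigr do under eq_bigr do rewrite mulr_sumr.
under [RHS]eq_bigr do rewrite exchange_big /=.
rewrite [RHS]exchange_big /=; apply: eq_bigr => d _.
rewrite mulr_sumr; apply: eq_bigr => a' _; rewrite mulr_sumr; apply: eq_bigr => b' _.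
rewrite !mulr_sumr; apply: eq_bigr => c' _; rewrite !mulr_sumr; apply: eq_bigr => d' _.
by ring.
Qed.

End FrameComponents.

(** * Curvature of a parallel pure spinor *)

Section FrameAlgebra.
Variables (F : fieldType) (n N : nat) (E g : 'M[F]_n) (X : 'M[F]_(n, N)).
Hypothesis Eon : E *m g *m E^T = 1%:M.

(** The spin connection [Cn] acts on the spinor index of [X] and drops out because X^T X = 0; the
    frame connection [W] becomes the Christoffel term for the coordinate components X^T E. *)
Lemma parallel_in_frame (DX : 'M[F]_(n, N)) (W DE Gam : 'M[F]_n) (Cn : 'M[F]_N) :
  g^T = g -> X^T *m X = 0 -> W = E *m g *m (DE + E *m Gam)^T ->
  (DX + W *m X + X *m Cn)^T *m X = 0 ->
  ((DX^T *m E + X^T *m DE) + X^T *m E *m Gam) *m g *m (X^T *m E)^T = 0.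
Proof.
move=> gT XX WE H.
have {}WE : W^T = (DE + E *m Gam) *m g *m E^T by rewrite WE !trmx_mul trmxK gT mulmxA.
have trE : (DX + W *m X + X *m Cn)^T = DX^T + X^T *m W^T + Cn^T *m X^T.
  by rewrite -!trmx_mul; apply/matrixP => i j; rewrite !mxE.
apply: etrans H; rewrite trE WE [RHS]mulmxDl [X in _ = X + _]mulmxDl.
rewrite -(mulmxA Cn^T) XX mulmx0 addr0.
rewrite trmx_mul trmxK -addrA -(mulmxA X^T) -mulmxDr !mulmxA !mulmxDl; congr (_ + _).
by rewrite -(mulmxA _ E) -(mulmxA _ (E *m g)) Eon mulmx1.
Qed.

(** The splitting writes a row orthogonal to N as a combination of rows of X^T E, to which the other
    row is orthogonal. *)
Lemma annihilator_null (K : 'M[F]_(N, n)) (Ya Yc : 'M[F]_(N, n)) :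
  X *m K + (X *m K)^T = 1%:M ->
  Ya *m g *m (X^T *m E)^T = 0 -> Yc *m g *m (X^T *m E)^T = 0 ->
  Ya *m g *m Yc^T = 0.
Proof.
move=> XK Ha Hc.
have gEE : g *m E^T *m E = 1%:M by apply: mulmx1C; rewrite mulmxA.
have YE (Y : 'M[F]_(N, n)) : Y = (Y *m g *m E^T) *m E by rewrite -!mulmxA (mulmxA g) gEE mulmx1.
have YX (Y : 'M[F]_(N, n)) : Y *m g *m (X^T *m E)^T = 0 -> (Y *m g *m E^T) *m X = 0.
  by rewrite trmx_mul trmxK mulmxA.
rewrite (YE Ya) (YE Yc); move: (YX _ Ha) (YX _ Hc).
move: (Ya *m g *m E^T) (Yc *m g *m E^T) => ya yc yaX ycX.
rewrite trmx_mul !mulmxA -(mulmxA ya E) -(mulmxA ya) Eon mulmx1 -[ya]mulmx1 -XK.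
rewrite mulmxDr mulmxA yaX mul0mx add0r trmx_mul -!mulmxA -trmx_mul ycX trmx0.
by rewrite !mulmx0.
Qed.

End FrameAlgebra.

Section ParallelSpinor.
Local Open Scope classical_set_scope.
Local Open Scope ring_scope.
Variables (R : realType) (m : nat) (cl : cliffordModule R m).
Local Notation C := (Cplx R).
Local Notation n := (2 * m)%N.
Local Notation N := (2 ^ m.-1)%N.
Variables (X : complexManifold R n) (g : holomorphicMetric X).
Variables (v : volumeForm g) (S : spinStructure cl v).
Variable xi : chart X -> 'rV[C]_n -> 'rV[C]_N.
Hypothesis hxi : projective_pure_spinor S xi.
Hypothesis hpar : parallel_projective S xi.
Variable i : chart X.
Local Notation A := (@img R n X i).
Let oA : open A := @img_open _ _ X i.
Local Notation E := (frame S i).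

Definition xi1_mx (w : 'rV[C]_n) : 'M[C]_(n, N) := \matrix_(b, B) xi1 cl (xi i w) b B.

Lemma xi1_split z : A z -> (xi1_mx z)^T *m xi1_mx z = 0 /\
  exists K, xi1_mx z *m K + (xi1_mx z *m K)^T = 1%:M.
Proof.
move=> Az; have [_ /(_ i z Az) [xi0 rk] _] := hxi.
have nm : n = (m + m)%N by rewrite mul2n addnn.
exact: (pure_kernel_split (gamPM cl) nm xi0 rk).
Qed.

Lemma xi1_holo : holomorphic_mx A xi1_mx.
Proof.
have [hx _ _] := hxi => b B.
have hc : holomorphic_mx A (fun=> gamP cl b) by move=> ? ?; exact: holo_cst.
apply: (holo_ext oA) (hmx_mul oA (hx i) hc 0 B) => z _.
by rewrite [RHS]mxE.
Qed.

(** Row A holds the coordinate components of xi^{aA}, a section of N over the chart. *)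
Definition null_frame (w : 'rV[C]_n) : 'M[C]_(N, n) := (xi1_mx w)^T *m E w.

Lemma null_frame_holo : holomorphic_mx A null_frame.
Proof. exact: (hmx_mul oA (hmx_tr oA xi1_holo) (frame_holomorphic S i)). Qed.

Lemma frame_on z : A z -> E z *m g i z *m (E z)^T = 1%:M.
Proof. by move=> Az; exact: frame_orthonormal. Qed.

Lemma omegaE a z : \matrix_(b, c) omega S i z a b c =
  E z *m g i z *m (mD a E z + E z *m levi_civita g i a z)^T.
Proof.
apply/matrixP => b c; rewrite mxE [RHS]mxE /omega exchange_big /=.
apply: eq_bigr => e _; rewrite [X in _ = X * _]mxE mulr_suml; apply: eq_bigr => d _.
congr (_ * _ * _); rewrite [RHS]mxE [RHS]mxE mDE; congr (_ + _).
rewrite [RHS]mxE; apply: eq_bigr => f _; rewrite [levi_civita _ _ _ _ _ _]mxE.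
exact: mulrC.
Qed.

Lemma nabla_null_frame a z : A z ->
  (mD a null_frame z + null_frame z *m levi_civita g i a z) *m g i z *m (null_frame z)^T = 0.
Proof.
move=> Az; have [XX _] := xi1_split Az.
have -> : mD a null_frame z = (mD a xi1_mx z)^T *m E z + (xi1_mx z)^T *m mD a E z.
  apply: etrans (mDM oA a (hmx_tr oA xi1_holo) (frame_holomorphic S i) Az) _.
  by rewrite mD_tr.
apply: (parallel_in_frame (frame_on Az) (gmx_sym g Az) XX (omegaE a z)
  (Cn := spin_connM S i z a)).
apply/matrixP => B D; rewrite [RHS]mxE -[RHS](hpar Az a B D) mxE; apply: eq_bigr => b _.
rewrite [X in X * _]mxE [X in _ * X]mxE; congr (_ * _).
rewrite /nabla_xi1 mxE [X in X + _]mxE; congr (_ + _ + _).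
- rewrite mDE; congr (pd _ _ _); by apply/funext => w; rewrite mxE.
- by rewrite mxE; apply: eq_bigr => c _; rewrite !mxE.
- by rewrite mxE; apply: eq_bigr => c _; rewrite !mxE.
Qed.

Lemma null_frame_curvature a c z : A z ->
  null_frame z *m curvature_mx (levi_civita g i) c a z *m g i z *m (null_frame z)^T = 0.
Proof.
have YY b d w : A w ->
    (mD b null_frame w + null_frame w *m levi_civita g i b w) *m g i w *m
    (mD d null_frame w + null_frame w *m levi_civita g i d w)^T = 0.
  move=> Aw; have [_ [K XK]] := xi1_split Aw.
  exact: (annihilator_null (frame_on Aw) XK (nabla_null_frame b Aw) (nabla_null_frame d Aw)).
have compat b w (Aw : A w) := levi_civita_compat g b Aw.
have hG := levi_civita_holo (frame_holomorphic S i) frame_on.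
exact: (curvature_stabilizes oA (gmx_holomorphic g i) hG compat null_frame_holo
  nabla_null_frame YY).
Qed.

End ParallelSpinor.

(** * The two forms of the cubic condition at a point *)

Section PointwiseStatement.
Local Open Scope classical_set_scope.
Local Open Scope ring_scope.
Variables (R : realType) (m : nat) (cl : cliffordModule R m).
Local Notation C := (Cplx R).
Local Notation n := (2 * m)%N.
Local Notation N := (2 ^ m.-1)%N.
Variable psi : 'rV[C]_N.
Variable K : 'I_N -> 'I_n -> C.
Hypothesis x_null : forall A B, \sum_a xi1 cl psi a A * xi1 cl psi a B = 0.
Hypothesis x_split : forall a b,
  \sum_A xi1 cl psi a A * K A b + \sum_A xi1 cl psi b A * K A a = (a == b)%:R.
Hypothesis x_x2 : forall A e D,
  \sum_a xi1 cl psi a A * xi2 cl psi a e D = xi1 cl psi e A * psi 0 D.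

Lemma xi2N a b A : xi2 cl psi a b A = - xi2 cl psi b a A.
Proof. by rewrite /xi2 -[in RHS]opprB scalerN mulmxN [in RHS]mxE opprK. Qed.

Lemma xi_gam e D : \sum_D' psi 0 D' * gamP cl e D' D = xi1 cl psi e D.
Proof. by rewrite /xi1 mxE. Qed.

(** The corrections in [PiC_1_m1] are built from [PiC_0_m1]; once the latter vanishes, the former is
    the triple contraction. Conversely, [triple_two_form] gives the vanishing of [PiC_0_m1]. *)
Lemma triple_PiC_m1 (T : 'I_n -> 'I_n -> 'I_n -> 'I_n -> C) :
  (forall a b c d, T a b c d = - T a b d c) ->
  (forall A B D d, \sum_a \sum_b \sum_c
      xi1 cl psi a A * xi1 cl psi b B * xi1 cl psi c D * T a b c d = 0) <->
  (forall A B C', PiC_0_m1 cl psi T A B C' = 0) /\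
  (forall A B D e, PiC_1_m1 cl psi T A B D e = 0).
Proof.
move=> T34.
have P1E : (forall A B C', PiC_0_m1 cl psi T A B C' = 0) -> forall A B D e,
    PiC_1_m1 cl psi T A B D e = \sum_a \sum_b \sum_c
      xi1 cl psi a A * xi1 cl psi b B * xi1 cl psi c D * T a b c e.
  move=> P0 A B D e; rewrite /PiC_1_m1.
  have Z A' B' D' : \sum_D'' PiC_0_m1 cl psi T A' B' D'' * gamP cl e D'' D' = 0.
    by rewrite big1 // => D'' _; rewrite P0 mul0r.
  by rewrite !Z subrr mulr0 subr0 mulr0 addr0.
split=> [tr|[P0 P1] A B D d]; last by rewrite -P1E.
suff P0 : forall A B C', PiC_0_m1 cl psi T A B C' = 0.
  by split=> // A B D e; rewrite P1E.
move=> A B C'; exact: (triple_two_form x_null x_split xi2N x_x2 C' T34 tr).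
Qed.

End PointwiseStatement.

Section ParallelCurvature.
Local Open Scope classical_set_scope.
Local Open Scope ring_scope.
Variables (R : realType) (m : nat) (cl : cliffordModule R m).
Local Notation C := (Cplx R).
Local Notation n := (2 * m)%N.
Local Notation N := (2 ^ m.-1)%N.
Variables (X : complexManifold R n) (g : holomorphicMetric X).
Variables (v : volumeForm g) (S : spinStructure cl v).
Variable xi : chart X -> 'rV[C]_n -> 'rV[C]_N.
Hypothesis hxi : projective_pure_spinor S xi.
Hypothesis hpar : parallel_projective S xi.
Variables (i : chart X) (z : 'rV[C]_n).
Hypothesis Az : img i z.
Local Notation psi := (xi i z).
Local Notation Rm := (frame_riemann S i z).

Lemma frame_riemann12 a b c d : Rm a b c d = - Rm b a c d.
Proof. exact: (frame_components12 (frame S i z) (fun a b c d => riemann12 g i a b c d z)). Qed.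

Lemma frame_riemann34 a b c d : Rm a b c d = - Rm a b d c.
Proof.
exact: (frame_components34 (frame S i z) (fun a b c d => riemann34
  (frame_holomorphic S i) (frame_on S (i := i)) a b c d Az)).
Qed.

Lemma frame_riemann_cyc a b c d : Rm a b c d + Rm b c a d + Rm c a b d = 0.
Proof.
exact: (frame_components_cyc (frame S i z) (fun a b c d => riemann_cyc g a b c d Az)).
Qed.

Lemma frame_riemann_pair a b c d : Rm a b c d = Rm c d a b.
Proof. exact: (riemann_pair_sym frame_riemann12 frame_riemann34 frame_riemann_cyc). Qed.

(** Parallelism gives the vanishing on the second pair, the one on which curvature acts as an
    endomorphism; pair symmetry moves it to the first. *)
Lemma frame_riemann_null A B c d :
  \sum_a \sum_b xi1 cl psi a A * xi1 cl psi b B * Rm a b c d = 0.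
Proof.
have XT a b : (xi1_mx cl xi i z)^T *m frame S i z *m
    (curvature_mx (levi_civita g i) a b z *m g i z) *m ((xi1_mx cl xi i z)^T *m frame S i z)^T = 0.
  by rewrite (mulmxA (_ *m frame S i z)); exact: (null_frame_curvature hxi hpar b a Az).
have H := frame_components_contract (fun a b c d => riemannE g i a b c d z) XT A B c d.
apply: etrans H; apply: eq_bigr => a _; apply: eq_bigr => b _.
by rewrite !mxE frame_riemann_pair.
Qed.

End ParallelCurvature.

Theorem proposition5p12 (R : realType) (m : nat) (hm : (2 < m)%N)
    (cl : cliffordModule R m) (X : complexManifold R (2 * m)%N)
    (g : holomorphicMetric X) (v : volumeForm g) (S : spinStructure cl v)
    (xi : chart X -> 'rV[Cplx R]_(2 * m)%N -> 'rV[Cplx R]_(2 ^ m.-1)%N)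
    (hxi : projective_pure_spinor S xi) (hpar : parallel_projective S xi) :
  forall (i : chart X) (z : 'rV[Cplx R]_(2 * m)%N), img i z ->
  let psi := xi i z in
  let Rm := frame_riemann S i z in
  let Phi := tracefree_ricci Rm in
  let W := weyl Rm in
  let triple (T : 'I_(2 * m) -> 'I_(2 * m) -> 'I_(2 * m) -> 'I_(2 * m) ->
      Cplx R) := forall A B D d,
    \sum_a \sum_b \sum_c
      xi1 cl psi a A * xi1 cl psi b B * xi1 cl psi c D * T a b c d = 0 in
  let Pi_m1 (T : 'I_(2 * m) -> 'I_(2 * m) -> 'I_(2 * m) -> 'I_(2 * m) ->
      Cplx R) :=
    (forall A B C', PiC_0_m1 cl psi T A B C' = 0) /\
    (forall A B D e, PiC_1_m1 cl psi T A B D e = 0) in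
  (forall A B c d,
     \sum_a \sum_b xi1 cl psi a A * xi1 cl psi b B * Rm a b c d = 0) /\
  (forall A B, \sum_a \sum_b xi1 cl psi a A * xi1 cl psi b B * Phi a b = 0) /\
  triple W /\ (triple W <-> Pi_m1 W) /\
  (forall T, weyl_type T -> (triple T <-> Pi_m1 T)) /\
  ((3 < m)%N -> forall A D b c, PiC_2_0 cl psi W A D b c = 0) /\
  (scalar_curv Rm = 0 <-> forall B' D', PiC_0_0 cl psi W B' D' = 0) /\
  ((forall A b, \sum_a xi1 cl psi a A * Phi a b = 0) <->
   (forall B' D d, PiC_1_0 cl psi W B' D d = 0)).
Proof.
move=> i z Az psi Rm Phi W triple Pi_m1.
have [_ /(_ i z Az) [xi0 _] _] := hxi.
have [XX [K XK]] := xi1_split hxi Az.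
have x_null A B : \sum_a xi1 cl psi a A * xi1 cl psi a B = 0.
  have /matrixP/(_ A B) := XX; rewrite !mxE; apply: etrans.
  by apply: eq_bigr => a _; rewrite !mxE.
have x_split a b : \sum_A xi1 cl psi a A * K A b + \sum_A xi1 cl psi b A * K A a = (a == b)%:R.
  have /matrixP/(_ a b) := XK; rewrite !mxE; apply: etrans.
  by congr (_ + _); apply: eq_bigr => A _; rewrite !mxE.
have x_x2 A e D : \sum_a xi1 cl psi a A * xi2 cl psi a e D = xi1 cl psi e A * psi 0 D.
  exact: (pure_contract_bivector (gamPM cl) A e D XX).
have n4 : (4 < 2 * m)%N by rewrite (leq_trans (n := 2 * 3)) // leq_mul2l.
have T12 a b c d : Rm a b c d = - Rm b a c d by exact: frame_riemann12.
have T34 a b c d : Rm a b c d = - Rm a b d c by exact: (frame_riemann34 S Az).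
have Tpair a b c d : Rm a b c d = Rm c d a b by exact: (frame_riemann_pair S Az).
have Tcyc a b c d : Rm a b c d + Rm b c a d + Rm c a b d = 0 by exact: (frame_riemann_cyc S Az).
have TN A B c d : \sum_a \sum_b xi1 cl psi a A * xi1 cl psi b B * Rm a b c d = 0.
  exact: (frame_riemann_null hxi hpar Az).
have RicE a b : ricci Rm a b = \sum_c Rm a c b c by [].
have RsE : scalar_curv Rm = \sum_a ricci Rm a a by [].
have PhiE a b : Phi a b = ricci Rm a b - scalar_curv Rm / (2 * m)%:R * (a == b)%:R by [].
have WE a b c d : W a b c d = Rm a b c d
  - 4 / ((2 * m)%:R - 2) * (4^-1 * (Phi c a * (b == d)%:R - Phi c b * (a == d)%:R
               - Phi d a * (b == c)%:R + Phi d b * (a == c)%:R))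
  - 2 / ((2 * m)%:R * ((2 * m)%:R - 1)) * scalar_curv Rm *
     (2^-1 * ((c == a)%:R * (b == d)%:R - (c == b)%:R * (a == d)%:R)) by [].
have W34' := weyl34 T34 WE.
have tr : triple W := weyl_null_triple x_null x_split Tpair TN RicE PhiE WE n4.
(* A nonzero component of the spinor, to be divided out in both equivalences. *)
have [B0 psiB0] : exists B, psi 0 B != 0 by apply/rV0Pn.
have nn k : (k <= 4)%N -> (2 * m)%:R - k%:R != 0 :> Cplx R := natr_sub_neq0 _ n4 (k := k).
have xg := xi_gam cl psi.
have x2N := xi2N cl psi.
split; first exact: TN.
split; first exact: (Phi_null_null x_null x_split Tpair TN RicE PhiE).
split; first exact: tr.
split; first exact: triple_PiC_m1.
split; first by move=> T [_ T34' _ _ _]; exact: triple_PiC_m1.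
split.
  move=> _; exact: (PiC_2_0_vanish x_null x_split T12 T34 Tpair Tcyc TN RicE RsE PhiE WE n4
    x2N x_x2 xg).
have P00 B' D' : PiC_0_0 cl psi W B' D' =
    - (2 * ((2 * m)%:R - 2) / ((2 * m)%:R - 1) * scalar_curv Rm) * psi 0 B' * psi 0 D'.
  exact: (x2_x2_W x_null x_split T12 T34 Tpair Tcyc TN RicE RsE PhiE WE n4 x2N x_x2).
have P10 B' D d : PiC_1_0 cl psi W B' D d = 2 * ((2 * m)%:R - 4) / ((2 * m)%:R - 2) * psi 0 B' *
    \sum_a xi1 cl psi a D * Phi a d.
  exact: (PiC_1_0_formula x_null x_split T12 T34 Tpair Tcyc TN RicE RsE PhiE WE n4 x2N x_x2 xg B' D d).
split; split.
- by move=> R0 B' D'; rewrite P00 R0 mulr0 oppr0 !mul0r.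
- move=> /(_ B0 B0); rewrite P00 => /eqP; rewrite !mulf_eq0 (negPf psiB0) !orbF oppr_eq0 !mulf_eq0.
  by rewrite invr_eq0 pnatr_eq0 (negPf (nn 2 isT)) (negPf (nn 1 isT)) /= => /eqP.
- by move=> H B' D d; rewrite P10 H mulr0.
(* Here one divides by n - 4, which is nonzero as m > 2. *)
- move=> H A b; have := H B0 A b; rewrite P10 => /eqP.
  rewrite !mulf_eq0 (negPf psiB0) invr_eq0 pnatr_eq0 (negPf (nn 2 isT)) (negPf (nn 4 isT)).
  by move=> /eqP.
Qed.
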